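(* Let $\Bbbk$ be a field and let $T$ be an unmixed balanced forest (every connected component is an unmixed balanced tree) with connected components $T_1,\dots,T_c$. Let $R=\Bbbk[V_{even}]$ and $R_i=\Bbbk[V_{even}(T_i)]$. For each $i$ let $Z_i\subseteq R_i$ be: $\{v\}$ if $T_i$ has height 0 with $V(T_i)=\{v\}$; $\{\ell_1-\ell_j: 2\le j\le n_0\}$ if $T_i$ has height 1 with leaves $\ell_1,\dots,\ell_{n_0}$; and $\{u_a-\ell_{a,b}: 1\le a\le n_1, 1\le b\le m_a\}$ if $T_i$ has height 3, where $V_1(T_i)=\{s_1,\dots,s_{n_1}\}$, $u_a$ is the unique height-2 vertex adjacent to $s_a$, and $\ell_{a,1},\dots,\ell_{a,m_a}$ are the leaves adjacent to $s_a$. Set $Z=\bigcup_{i=1}^cZ_i$. Then (1) $Z$ is a maximal $R/\mathcal{N}_{odd}(T)$-regular sequence in the ideal $(V_{even})R$; (2) $\mathrm{type}(R/\mathcal{N}_{odd}(T))$ equals the number of minimal $V_3$-TD-sets of $T$.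
   Context: $N(v)=\{u:uv\in E\}$, $N(D)=\bigcup_{v\in D}N(v)$, $X_U=\prod_{v\in U}v$. A leaf is a vertex of degree 1; height of a vertex = minimum distance to a leaf (isolated vertex: 0); $V_k$ = height-$k$ vertices; $V_{even}$, $V_{odd}$ = vertices of even/odd height; a tree is balanced if no two adjacent vertices have equal height. A TD-set is $D$ with $N(D)=V$, minimal if no proper subset is; a tree is unmixed if all minimal TD-sets have the same size. Unmixed balanced trees have height 0, 1 or 3, and in one of height 3 each height-1 vertex has exactly one height-2 neighbor. $\mathcal{N}_{odd}(T)$ is the ideal of $R$ generated by $X_{N(v)}$, $v\in V_{odd}$. A $V_3$-TD-set is $D$ with $N(D)\supseteq V_3$, minimal if no proper subset is one. $\mathrm{type}$ denotes Cohen–Macaulay type. *)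

(* Defs.v *)
From HB Require Import structures.
From mathcomp Require Import all_boot all_order all_algebra.
From mathcomp Require Import mpoly.
Set Implicit Arguments. Unset Strict Implicit. Unset Printing Implicit Defensive.
Import GRing.Theory.
Local Open Scope ring_scope.

Section Graph.
Variable n : nat.
Variable e : rel 'I_n.

Definition simple_graph := ssrbool.symmetric e /\ irreflexive e.
Definition forest :=
  simple_graph /\ forall s : seq 'I_n, uniq s -> (3 <= size s)%N -> ~~ cycle e s.

Definition nbhd (v : 'I_n) : {set 'I_n} := [set u | e v u].
Definition nbhdS (D : {set 'I_n}) : {set 'I_n} := \bigcup_(v in D) nbhd v.
Definition leaf (v : 'I_n) : bool := #|nbhd v| == 1%N.

Fixpoint ball (v : 'I_n) (k : nat) : {set 'I_n} :=
  if k is k'.+1 then ball v k' :|: nbhdS (ball v k') else [set v].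

Definition height (v : 'I_n) : nat :=
  if nbhd v == set0 then 0%N
  else find (fun k => [exists l in ball v k, leaf l]) (iota 0 n).

Definition Vk (k : nat) : {set 'I_n} := [set v | height v == k].
Definition Veven : {set 'I_n} := [set v | ~~ odd (height v)].
Definition Vodd : {set 'I_n} := [set v | odd (height v)].

Definition balanced := forall u v, e u v -> height u != height v.

Definition comp (v : 'I_n) : {set 'I_n} := [set u | connect e v u].
Definition compheight (v : 'I_n) : nat := \max_(u in comp v) height u.

Definition TDset_of (C D : {set 'I_n}) : bool := (D \subset C) && (C \subset nbhdS D).
Definition unmixed_comp (C : {set 'I_n}) :=
  forall D1 D2, minset (TDset_of C) D1 -> minset (TDset_of C) D2 -> #|D1| = #|D2|.

Definition unmixed_balanced_forest :=
  [/\ forest, balanced & forall v, unmixed_comp (comp v)].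

Definition V3TD (D : {set 'I_n}) : bool := Vk 3 \subset nbhdS D.
Definition num_min_V3TD : nat := #|[set D : {set 'I_n} | minset V3TD D]|.

(* ---- Algebra: R = K[V_even] inside K[x_v : v in 'I_n] ---- *)
Variable K : fieldType.
Notation P := {mpoly K[n]}.

Definition inR (p : P) : Prop :=
  forall m, m \in msupp p -> forall i, (0 < m i)%N -> i \in Veven.

Definition XU (U : {set 'I_n}) : P := \prod_(i in U) 'X_i.

Definition ideal_gen (G : P -> Prop) (f : P) : Prop :=
  exists s : seq (P * P),
    (forall rg, rg \in s -> inR rg.1 /\ G rg.2) /\ f = \sum_(rg <- s) rg.1 * rg.2.

Definition Nodd_gen (g : P) : Prop := exists v, v \in Vodd /\ g = XU (nbhd v).
Definition mgen (g : P) : Prop := exists v, v \in Veven /\ g = 'X_v.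

Definition Nplus (xs : seq P) (g : P) : Prop := Nodd_gen g \/ g \in xs.

Definition regular_on (G : P -> Prop) (x : P) : Prop :=
  inR x /\ forall f, inR f -> ideal_gen G (x * f) -> ideal_gen G f.

Definition regular_seq (xs : seq P) : Prop :=
  (forall j, (j < size xs)%N -> regular_on (Nplus (take j xs)) (nth 0 xs j)) /\
  ~ ideal_gen (Nplus xs) 1.

Definition maximal_regular_seq_in_m (xs : seq P) : Prop :=
  [/\ regular_seq xs, (forall x, x \in xs -> ideal_gen mgen x) &
      forall y, ideal_gen mgen y -> ~ regular_seq (rcons xs y)].

Definition in_socle (G : P -> Prop) (f : P) : Prop :=
  inR f /\ forall v, v \in Veven -> ideal_gen G ('X_v * f).

Definition socle_indep (G : P -> Prop) (fs : seq P) : Prop :=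
  (forall f, f \in fs -> in_socle G f) /\
  forall c : seq K, size c = size fs ->
    ideal_gen G (\sum_(i < size fs) c`_i *: fs`_i) -> forall i, c`_i = 0.

Definition socle_dim (G : P -> Prop) (t : nat) : Prop :=
  (exists fs, size fs = t /\ socle_indep G fs) /\
  forall fs, socle_indep G fs -> (size fs <= t)%N.

Definition CM_type_is (t : nat) : Prop :=
  forall xs, maximal_regular_seq_in_m xs -> socle_dim (Nplus xs) t.

(* The set Z; rep selects the leaf l_1 of each height-1 component *)
Definition Zset (rep : 'I_n -> 'I_n) (p : P) : Prop :=
  (exists v, nbhd v = set0 /\ p = 'X_v) \/
  (exists l, [/\ leaf l, compheight l = 1%N, l != rep l & p = 'X_(rep l) - 'X_l]) \/
  (exists s u l, height s = 1%N /\ height u = 2%N /\ leaf l /\ e s u /\ e s l /\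
                     compheight s = 3%N /\ p = 'X_u - 'X_l).

Definition good_rep (rep : 'I_n -> 'I_n) : Prop :=
  (forall v, compheight v = 1%N -> connect e v (rep v) /\ leaf (rep v)) /\
  (forall u v, connect e u v -> rep u = rep v).

End Graph.

(* Main.v *)
(* In an unmixed balanced forest the minimal transversals [D] of the neighborhoods of odd vertices all have
   the same size. By Konig's property of forests that size is the size of a family of disjoint
   neighborhoods, so every [D] meets each of them exactly once; avoidance arguments then force the family to
   consist of the neighborhoods of the height-1 vertices, each with at most one vertex that is not a leaf.
   Modulo [Z] all the variables of such a neighborhood are identified to a single one, its pivot, and at every
   stage the quotient is defined by a monomial ideal. This gives regularity term by term; at the end the ideal
   is generated by the powers [y_s ^ deg s] of the pivots and by squarefree monomials indexed by [V_3], whose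
   monomial socle elements correspond to the minimal [V_3]-TD-sets.
   That the type does not depend on the maximal regular sequence (whose terms need not be homogeneous) follows
   from prime avoidance: two maximal regular sequences can be exchanged for sequences starting with a common
   regular element, and exchanging one regular element for another does not change the socle. *)

Require Import Defs.
From mathcomp Require Import all_boot all_order all_algebra.
From mathcomp Require Import mpoly ring zify.
From Stdlib Require Import Classical ClassicalEpsilon FunctionalExtensionality PropExtensionality.
Set Implicit Arguments. Unset Strict Implicit. Unset Printing Implicit Defensive.
Import Order.TTheory GRing.Theory.
Local Open Scope ring_scope.

(** * Regular sequences and socles *)

Section Ideals.
Variable A : comNzRingType.
Implicit Types (J Q : A -> Prop) (a b f x z : A) (xs : seq A).

(** Regular sequences in [R] need not be permutable, since [R] is not local. So the exchange only
    moves forward an element regular on every intermediate quotient, and maximality of a sequence is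
    used solely as a nonzero socle at its end. Unmixedness speaks of TD-sets, not of transversals.
    Parity of height is a two-coloring, so a TD-set of a component splits into an even part meeting
    the odd neighborhoods and an odd part meeting the even ones; freezing the odd part leaves the
    even transversals. An avoidance argument excludes a set [A] of vertices that fills some
    neighborhood up to one vertex, which is thereby forced into the transversal; one forced vertex
    too many violates the packing bound. Cycles are excluded in order to see that [A] fills no
    neighborhood entirely. *)

Definition is_ideal J :=
  [/\ J 0, forall a b, J a -> J b -> J (a + b) & forall a b, J b -> J (a * b)].

Definition colon J f a := J (a * f).
Definition addI J x f := exists a, J (f - a * x).
Definition nonzerodiv J x := forall f, J (x * f) -> J f.

(** A single stationary step is demanded rather than eventual stability; this already refutes
    strictly increasing chains, the only use made of it. *)
Definition noetherian :=
  forall Js : nat -> A -> Prop, (forall i, is_ideal (Js i)) ->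
    (forall i a, Js i a -> Js i.+1 a) -> exists i, forall a, Js i.+1 a -> Js i a.

Lemma idealB J a b : is_ideal J -> J a -> J b -> J (a - b).
Proof.
by case=> _ JD JM Ja Jb; apply: JD => //; rewrite -mulN1r; apply: JM.
Qed.

Lemma ideal_sum J (I : eqType) (r : seq I) (F : I -> A) :
  is_ideal J -> (forall i, i \in r -> J (F i)) -> J (\sum_(i <- r) F i).
Proof.
move=> [J0 JD _] JF; rewrite big_seq_cond; apply: (big_ind J) => // i.
by case/andP=> /JF.
Qed.

Lemma ideal_subl J a b : is_ideal J -> J (a - b) -> J b -> J a.
Proof. by case=> _ JD _ Jab Jb; rewrite -[a](subrK b); apply: JD. Qed.

Lemma colon_ideal J f : is_ideal J -> is_ideal (colon J f).
Proof.
case=> J0 JD JM; rewrite /colon; split=> [|a b|a b]; first by rewrite mul0r.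
- by rewrite mulrDl; apply: JD.
- by rewrite -mulrA; apply: JM.
Qed.

Lemma addI_ideal J x : is_ideal J -> is_ideal (addI J x).
Proof.
case=> J0 JD JM; split; first by exists 0; rewrite mul0r subr0.
- move=> a b [c Jc] [d Jd]; exists (c + d).
  by rewrite mulrDl opprD addrACA; apply: JD.
- by move=> a b [c Jc]; exists (a * c); rewrite -mulrA -mulrBr; apply: JM.
Qed.

Lemma addI_incl J x f : J f -> addI J x f.
Proof. by exists 0; rewrite mul0r subr0. Qed.

Lemma addI_self J x : is_ideal J -> addI J x x.
Proof. by case=> J0 _ _; exists 1; rewrite mul1r subrr. Qed.

Lemma addI_sub J Q x : is_ideal Q -> (forall f, J f -> Q f) -> Q x ->
  forall f, addI J x f -> Q f.
Proof.
move=> iQ JQ Qx f [a /JQ Jf]; apply: (ideal_subl iQ Jf).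
by case: iQ => _ _; apply.
Qed.

Lemma addIC J x z : addI (addI J x) z = addI (addI J z) x.
Proof.
apply: functional_extensionality => f; apply: propositional_extensionality.
by split=> -[a [b Jf]]; exists b, a; rewrite addrAC.
Qed.

Lemma foldl_addI_ideal J xs : is_ideal J -> is_ideal (foldl addI J xs).
Proof. by elim: xs J => //= x xs IH J iJ; apply/IH/addI_ideal. Qed.

Lemma foldl_addIC J xs z :
  foldl addI (addI J z) xs = addI (foldl addI J xs) z.
Proof. by elim: xs J => //= x xs IH J; rewrite -IH addIC. Qed.

Lemma foldl_addI_sub J xs f : J f -> foldl addI J xs f.
Proof. by elim: xs J => //= x xs IH J Jf; apply/IH/addI_incl. Qed.

Lemma foldl_addI_mem J xs x : is_ideal J -> x \in xs -> foldl addI J xs x.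
Proof.
elim: xs J => //= y xs IH J iJ; rewrite inE => /predU1P[->|].
  by apply/foldl_addI_sub/addI_self.
by apply/IH/addI_ideal.
Qed.

Lemma foldl_addI_le J Q xs f : is_ideal Q -> (forall g, J g -> Q g) ->
  (forall x, x \in xs -> Q x) -> foldl addI J xs f -> Q f.
Proof.
move=> iQ; elim: xs J => [J JQ _|x xs IH J JQ xQ] /=; first exact: JQ.
apply: IH => [g|y yxs]; last by apply: xQ; rewrite inE yxs orbT.
by apply: addI_sub => //; apply: xQ; rewrite inE eqxx.
Qed.

Lemma noetherian_max (F : (A -> Prop) -> Prop) J0 :
  noetherian -> (forall J, F J -> is_ideal J) -> F J0 ->
  exists J, [/\ F J, forall a, J0 a -> J a &
    forall J', F J' -> (forall a, J a -> J' a) -> forall a, J' a -> J a].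
Proof.
move=> noethA Fi FJ0; apply: NNPP => nomax.
pose G J := F J /\ (forall a, J0 a -> J a).
have step (J : {J | G J}) : {J' : {J | G J} | (forall a, sval J a -> sval J' a) /\
    ~ (forall a, sval J' a -> sval J a)}.
  apply: constructive_indefinite_description; apply: NNPP => nstep.
  case: J nstep => J [FJ J0J] /= nstep; apply: nomax; exists J; split=> // J' FJ' JJ'.
  apply: NNPP => nJ'J; apply: nstep.
  have GJ' : G J' by split=> // a /J0J /JJ'.
  by exists (exist _ J' GJ').
have GJ0 : G J0 by [].
pose Js := fix Js i := if i is j.+1 then sval (step (Js j)) else exist G J0 GJ0.
have [i||i] := noethA (fun i => sval (Js i)).
- by case: (Js i) => J [FJ ?]; apply: Fi.
- by move=> i a; rewrite /=; case: (step _) => J' /= [+ _]; apply.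
- by rewrite /=; case: (step _) => J' /= [_ +]; apply.
Qed.

(** * Annihilator primes and prime avoidance *)

Definition prime_ideal Q :=
  [/\ is_ideal Q, ~ Q 1 & forall a b, Q (a * b) -> Q a \/ Q b].

(** The ideal [colon J f] is maximal among the annihilators of nonzero elements of the quotient by
    [J]; it stands in for an associated prime. *)
Definition max_ann J f := ~ J f /\
  forall g, ~ J g -> (forall a, J (a * f) -> J (a * g)) -> forall a, J (a * g) -> J (a * f).

(** If [a * f] is outside [J], its annihilator contains that of [f], hence equals it by maximality;
    so [b], which kills [a * f], kills [f]. *)
Lemma max_ann_prime J f : is_ideal J -> max_ann J f -> prime_ideal (colon J f).
Proof.
move=> iJ [Jf fmax]; split; [exact: colon_ideal | by rewrite /colon mul1r|].
move=> a b Jabf; case: (classic (colon J f a)) => [|Jaf]; [by left|right].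
have [_ _ JM] := iJ; apply: (fmax (a * f)) => // [c Jcf|].
  by rewrite mulrCA; apply: JM.
by rewrite mulrA [b * a]mulrC.
Qed.

Lemma max_ann_above J g : noetherian -> is_ideal J -> ~ J g ->
  exists2 f, max_ann J f & forall a, J (a * g) -> J (a * f).
Proof.
move=> noethA iJ Jg.
pose F Q := exists2 f, ~ J f & Q = colon J f.
have [|Q [[f Jf ->] gf fmax]] := @noetherian_max F (colon J g) noethA _ (ex_intro2 _ _ g Jg erefl).
  by move=> Q [f _ ->]; apply: colon_ideal.
exists f => //; split=> // h Jh fh; apply: fmax => //; by exists h.
Qed.

Lemma prime_finite_inter Q J (l : seq A) : prime_ideal Q -> is_ideal J ->
  (forall f, f \in l -> exists2 a, J (a * f) & ~ Q a) ->
  exists2 a, forall f, f \in l -> J (a * f) & ~ Q a.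
Proof.
move=> [iQ Q1 QM] [_ _ JM]; elim: l => [_|g l IH lP]; first by exists 1.
have [|a aP Qa] := IH; first by move=> f fl; apply: lP; rewrite inE fl orbT.
have [|b bP Qb] := lP g; first by rewrite inE eqxx.
exists (a * b); last by case/QM.
move=> f; rewrite inE => /predU1P[->|/aP aP']; first by rewrite -mulrA; apply: JM.
by rewrite [a * b]mulrC -mulrA; apply: JM.
Qed.

(** With [l] chosen so that [J + (l)] is maximal, every [f] with maximal annihilator is a
    combination of [l] modulo [J]. If no member of [l] had its annihilator inside the prime
    [colon J f], a product of witnesses would kill [l] but not [f]. So the annihilator of [f]
    already occurs in [l]. *)
Lemma finite_max_ann J : noetherian -> is_ideal J ->
  exists2 l : seq A, (forall f, f \in l -> max_ann J f) &
    forall x, ~ nonzerodiv J x -> exists2 f, f \in l & J (x * f).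
Proof.
move=> noethA iJ.
pose F Q := exists2 l : seq A, (forall f, f \in l -> max_ann J f) & Q = foldl addI J l.
have [||Q [[l lmax ->] _ Qmax]] := @noetherian_max F J noethA.
- by move=> Q [l _ ->]; apply: foldl_addI_ideal.
- by exists [::].
exists l; first exact: lmax.
move=> x ndx; have [g Jxg Jg] : exists2 g, J (x * g) & ~ J g.
  apply: NNPP => ng; apply: ndx => g Jxg; apply: NNPP => Jg.
  by apply: ng; exists g.
have [f fmax gf] := max_ann_above noethA iJ Jg.
have fP := max_ann_prime iJ fmax.
have Jf : foldl addI J l f.
  apply: (Qmax (foldl addI J (f :: l))).
  - by exists (f :: l) => // h; rewrite inE => /predU1P[->|/lmax].
  - by move=> a /=; rewrite foldl_addIC; apply: addI_incl.
  - by apply: foldl_addI_mem => //; rewrite inE eqxx.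
apply: NNPP => nf.
have [|a aP Qa] := prime_finite_inter (l := l) fP iJ.
  move=> h hl; apply: NNPP => nh; apply: nf; exists h => //.
  have hf a : J (a * h) -> J (a * f).
    by move=> Jah; apply: NNPP => nJaf; apply: nh; exists a.
  by have [_ hmax] := lmax h hl; apply: hmax (gf _ Jxg) => //; case: fmax.
apply: Qa; have [J0 JD JM] := iJ.
have : colon J a f; last by rewrite /colon mulrC.
apply: (@foldl_addI_le J (colon J a) l f) => // [|g' Jg'|h hl].
- exact: colon_ideal.
- by rewrite /colon mulrC; apply: JM.
- by rewrite /colon mulrC; apply: aP.
Qed.

(** Induction on the number of primes. A prime of the tail contained in the head [P] is dropped.
    Otherwise a [z] avoiding the tail, if it falls in [P], is corrected by [w * b] with [b] in [m]
    and [w] in all primes of the tail, both outside [P]. *)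
Lemma prime_avoidance (m : A -> Prop) (Ps : list (A -> Prop)) : is_ideal m ->
  (forall Q, List.In Q Ps -> prime_ideal Q /\ exists2 a, m a & ~ Q a) ->
  exists2 z, m z & forall Q, List.In Q Ps -> ~ Q z.
Proof.
move=> im; move: {2}(size Ps) (leqnn (size Ps)) => k.
elim: k Ps => [|k IH] [|P Ps] //= szPs PsP; try by exists 0 => //; case: im.
have [[Q []]|nsub] := classic (exists Q, List.In Q Ps /\ forall a, Q a -> P a).
  move=> QPs QP; have [L1 [L2 defPs]] := List.in_split Q Ps QPs.
  have inPs Q' : List.In Q' (P :: L1 ++ L2) -> List.In Q' (P :: Ps).
    rewrite defPs /= => -[->|]; first by left.
    move/(List.in_app_or L1 L2) => Q'L; right; apply: List.in_or_app.
    by case: Q'L; [left|right; right].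
  have [||z mz zP] := IH (P :: L1 ++ L2).
  - have szapp (L L' : list (A -> Prop)) : size (List.app L L') = (size L + size L')%N.
      exact: size_cat.
    by move: szPs; rewrite defPs /= !szapp /= addnS.
  - by move=> Q' /inPs; apply: PsP.
  exists z => // Q' [<-|]; first by apply: zP; left.
  rewrite defPs => /(List.in_app_or L1 (Q :: L2)) [Q'1|[<-|Q'2]].
  - by apply: zP; right; apply: List.in_or_app; left.
  - by move/QP; apply: zP; left.
  - by apply: zP; right; apply: List.in_or_app; right.
have [||z mz zP] := IH Ps => //; first by move=> Q QPs; apply: PsP; right.
have [Pz|nPz] := classic (P z); last first.
  by exists z => // Q [<-|/zP].
have [[iP P1 PM] [b mb Pb]] := PsP P (or_introl erefl).
have [w [wPs Pw]] : exists w, (forall Q, List.In Q Ps -> Q w) /\ ~ P w.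
  have: forall Q, List.In Q Ps -> is_ideal Q /\ exists2 a, Q a & ~ P a.
    move=> Q QPs; have [[iQ _ _] _] := PsP Q (or_intror QPs); split=> //.
    apply: NNPP => nQ; apply: nsub; exists Q; split=> // a Qa.
    by apply: NNPP => nPa; apply: nQ; exists a.
  elim: (Ps) => [_|Q L IHL LP]; first by exists 1; split.
  have [|w [wL Pw]] := IHL; first by move=> Q' Q'L; apply: LP; right.
  have [[_ _ QM] [a Qa Pa]] := LP Q (or_introl erefl).
  exists (w * a); split=> [Q' [<-|Q'L]|]; first exact: QM.
    have [[_ _ Q'M] _] := LP Q' (or_intror Q'L).
    by rewrite mulrC; apply: Q'M; apply: wL.
  by case/PM.
have [m0 mD mM] := im.
exists (z + w * b) => [|Q [<-|QPs] Qzwb]; first by apply: mD => //; apply: mM.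
  have : P (w * b) by apply: (ideal_subl iP (b := - z)); rewrite ?opprK 1?addrC // -mulN1r; case: iP => _ _; apply.
  by case/PM.
have [[iQ _ _] _] := PsP Q (or_intror QPs).
apply: (zP Q QPs); rewrite -[z](addrK (w * b)); apply: idealB => //.
by rewrite mulrC; case: iQ => _ _; apply; apply: wPs.
Qed.

(** An annihilator prime [colon J f] containing [m] would put [f] in the socle of [J], assumed
    trivial; prime avoidance over the finitely many annihilators of all the [J] then gives [z]. *)
Lemma common_nonzerodiv (m : A -> Prop) (Js : list (A -> Prop)) :
  noetherian -> is_ideal m ->
  (forall J, List.In J Js -> is_ideal J /\
     forall f, (forall a, m a -> J (a * f)) -> J f) ->
  exists2 z, m z & forall J, List.In J Js -> nonzerodiv J z.
Proof.
move=> noethA im JsP.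
have [Ps PsP PsJ] : exists2 Ps : list (A -> Prop),
    (forall Q, List.In Q Ps -> prime_ideal Q /\ exists2 a, m a & ~ Q a) &
    forall z, (forall Q, List.In Q Ps -> ~ Q z) -> forall J, List.In J Js -> nonzerodiv J z.
  elim: Js JsP => [_|J Js IH JsP]; first by exists [::].
  have [|Ps PsP PsJ] := IH; first by move=> Q QJs; apply: JsP; right.
  have [iJ Jm] := JsP J (or_introl erefl).
  have [l lmax lP] := finite_max_ann noethA iJ.
  exists (List.app (List.map (colon J) l) Ps) => [Q|z zP Q [<-|]].
  - move/(List.in_app_or (List.map (colon J) l) Ps); case=> [QL|/PsP //].
    have [f [<- fl0]] := proj1 (List.in_map_iff (colon J) l Q) QL.
    have fl : f \in l by elim: (l) fl0 => //= h l' IHl [->|/IHl]; rewrite inE ?eqxx // => ->; rewrite orbT.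
    split; first exact: (max_ann_prime iJ (lmax f fl)).
    apply: NNPP => nf; case: (lmax f fl) => + _; apply; apply: Jm => a ma.
    by apply: NNPP => nJaf; apply: nf; exists a.
  - apply: NNPP => /lP[f fl Jzf]; apply: (zP (colon J f)) => //.
    apply: List.in_or_app; left; apply: List.in_map.
    by elim: (l) fl => //= h l' IHl; rewrite inE => /predU1P[->|/IHl]; [left|right].
  - by apply: PsJ => Q' Q'Ps; apply: zP; apply: List.in_or_app; right.
by have [z mz zP] := prime_avoidance im PsP; exists z => //; apply: PsJ.
Qed.

(** * Regular sequences and their exchange *)

Fixpoint regseq J xs :=
  if xs is x :: xs' then nonzerodiv J x /\ regseq (addI J x) xs' else True.

Fixpoint chain J xs : list (A -> Prop) :=
  if xs is x :: xs' then J :: chain (addI J x) xs' else [:: J].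

Lemma regseq_rcons J xs x :
  regseq J (rcons xs x) <-> regseq J xs /\ nonzerodiv (foldl addI J xs) x.
Proof.
elim: xs J => [|y xs IH] J /=; first by split=> [[]|[]].
by rewrite IH; split=> [[? []]|[[? ?]] ?].
Qed.

(** One step: if [x * f] equals [a * z] modulo [J], regularity of [z] modulo [J + (x)] writes [a] as
    [c * x], and cancelling [x] puts [f - c * z] in [J]. *)
Lemma regseq_addI J xs z : is_ideal J -> regseq J xs ->
  (forall Q, List.In Q (chain J xs) -> nonzerodiv Q z) -> regseq (addI J z) xs.
Proof.
elim: xs J => //= x xs IH J iJ [Jx Jxs] zP.
have Jz : nonzerodiv J z by apply: zP; left.
have [J0 JD JM] := iJ.
split; last first.
  by rewrite addIC; apply: IH => //; [exact: addI_ideal | move=> Q HQ; apply: zP; right].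
move=> f [a Jxfaz].
have [c Jac] : addI J x a.
  apply: (zP (addI J x)); first by right; case: (xs) => [|? ?]; left.
  exists f; have -> : z * a - f * x = -1 * (x * f - a * z) by ring.
  exact: JM.
exists c; apply: Jx.
have -> : x * (f - c * z) = x * f - a * z + z * (a - c * x) by ring.
by apply: JD => //; apply: JM.
Qed.

Section Socle.
Variable m : A -> Prop.

Definition socle J f := forall a, m a -> J (a * f).

Lemma chain_ideal J xs Q : is_ideal J -> List.In Q (chain J xs) -> is_ideal Q.
Proof.
elim: xs J => [|x xs IH] J iJ /=; first by case=> // <-.
by case=> [<- //|]; apply/IH/addI_ideal.
Qed.

(** Each ideal of [chain J xs] is followed in the sequence by an element of [m] regular on it, which
    can be cancelled; [x] does this for the last ideal. *)
Lemma chain_socle J xs x Q : (forall y, y \in rcons xs x -> m y) ->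
  regseq J (rcons xs x) -> List.In Q (chain J xs) -> forall f, socle Q f -> Q f.
Proof.
elim: xs J => [|y xs IH] J xsm /= [Jy Jxs].
  by case=> // <- f Jf; apply: Jy; apply: Jf; apply: xsm; rewrite inE eqxx.
case=> [<- f Jf|]; first by apply: Jy; apply: Jf; apply: xsm; rewrite inE eqxx.
by apply: IH => // y' y'xs; apply: xsm; rewrite inE y'xs orbT.
Qed.

End Socle.
End Ideals.

Arguments addI {A} J x f.

Section SocleDimension.
Variables (K : fieldType) (A : comAlgType K) (m : A -> Prop).
Hypotheses (im : is_ideal m) (noethA : noetherian A).
Implicit Types (J : A -> Prop).

(** A lower bound on the socle dimension, so that finiteness need not be known beforehand. With
    [t = 1] it says that the socle is nonzero. *)
Definition socle_free J t := exists fs : seq A,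
  [/\ size fs = t, forall f, f \in fs -> socle m J f &
   forall c : seq K, size c = t -> J (\sum_(i < t) c`_i *: fs`_i) -> forall i, c`_i = 0].

(* If [x] and [z] are both regular on [J], sending [f] to the [g] with
   [z f = x g] modulo [J] embeds the socle of [J + (x)] in that of [J + (z)]. *)
Lemma socle_free_exchange J x z t : is_ideal J -> m x -> m z ->
  nonzerodiv J x -> nonzerodiv J z ->
  socle_free (addI J x) t -> socle_free (addI J z) t.
Proof.
move=> iJ mx mz Jx Jz [fs [szfs fsm fsfree]]; have [J0 JD JM] := iJ.
have gP f : {g | f \in fs -> J (z * f - g * x)}.
  apply: constructive_indefinite_description.
  case: (boolP (f \in fs)) => [/fsm/(_ z mz)[g Jg]|_]; last by exists 0.
  by exists g.
have gfs i : (i < t)%N -> (map (fun f => sval (gP f)) fs)`_i = sval (gP fs`_i).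
  by move=> it; rewrite (nth_map 0) ?szfs.
have gE i : (i < t)%N -> J (z * fs`_i - sval (gP fs`_i) * x).
  by move=> it; apply: (svalP (gP _)); rewrite mem_nth ?szfs.
exists (map (fun f => sval (gP f)) fs); split; first by rewrite size_map.
- move=> _ /mapP[f ffs ->]; case: (gP f) => g /= /(_ ffs) Jg a ma.
  have [h Jh] := fsm f ffs a ma.
  exists h; apply: Jx.
  have -> : x * (a * g - h * z) = z * (a * f - h * x) - a * (z * f - g * x).
    by ring.
  by apply: idealB => //; apply: JM.
- move=> c szc [h Jh]; apply: fsfree => //; exists h; apply: Jz.
  set F := \sum_(i < t) _; set G := \sum_(i < t) _ in Jh.
  have JFG : J (z * F - x * G).
    rewrite !mulr_sumr -sumrB; apply: ideal_sum => // i _.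
    rewrite -!scalerAr -scalerBr -mulr_algl; apply: JM.
    by rewrite gfs // [x * _]mulrC; apply: gE.
  have -> : z * (F - h * x) = z * F - x * G + x * (G - h * z) by ring.
  by apply: JD => //; apply: JM.
Qed.

Lemma socle_free_sub J t : socle_free J t.+1 -> exists2 f, socle m J f & ~ J f.
Proof.
case=> fs [szfs fsm fsfree]; exists fs`_0; first by apply: fsm; rewrite mem_nth ?szfs.
move=> Jf; pose c : seq K := 1 :: nseq t 0.
suff /(_ 0%N) /eqP : forall i, c`_i = 0 by rewrite /= oner_eq0.
apply: fsfree; first by rewrite /= size_nseq.
rewrite big_ord_recl /= scale1r big1 ?addr0 // => i _.
by rewrite /= nth_nseq if_same scale0r.
Qed.

Lemma socle_free1 J f : is_ideal J -> socle m J f -> ~ J f -> socle_free J 1.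
Proof.
move=> [_ _ JM] Jf nJf; exists [:: f]; split=> // [g|c szc]; first by rewrite inE => /eqP->.
rewrite big_ord1 /= => Jcf [|i]; last by rewrite nth_default // szc.
apply: NNPP => /eqP c0; apply: nJf.
rewrite -[f](scalerK c0) -[_ *: (_ *: _)]mulr_algl; exact: JM.
Qed.

(* An element [z] regular on all the intermediate quotients of both sequences replaces their last terms
   and is then moved to the front. *)
Theorem socle_free_regseq J xs ys : is_ideal J ->
  (forall x, x \in xs -> m x) -> (forall y, y \in ys -> m y) ->
  regseq J xs -> regseq J ys ->
  socle_free (foldl addI J xs) 1 -> socle_free (foldl addI J ys) 1 ->
  forall t, socle_free (foldl addI J xs) t -> socle_free (foldl addI J ys) t.
Proof.
(* Equal lengths are not assumed: a regular element of [m] excludes a nonzero socle, so the two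
   sequences run out together. *)
have no_socle x J0 : m x -> nonzerodiv J0 x -> socle_free J0 1 -> False.
  by move=> mx J0x /socle_free_sub[f fsoc]; apply; apply: J0x; apply: fsoc.
move: {2}(size xs) (erefl (size xs)) => d; elim: d J xs ys => [|d IH] J.
  move=> [] // [|y ys] // _ _ _ ysm _ [Jy _] soc1.
  by case: (no_socle y J) => //; apply: ysm; rewrite inE eqxx.
case/lastP=> [//|xs x] ys; rewrite size_rcons => -[szxs] iJ xsm.
case/lastP: ys => [_|ys y ysm Jxs Jys].
  case: xs szxs xsm => [|x' xs] _ xsm [Jx _] _ _ soc1.
    by case: (no_socle x J) => //; apply: xsm; rewrite inE eqxx.
  by case: (no_socle x' J) => //; apply: xsm; rewrite inE eqxx.
have [xsJ xJ] := proj1 (regseq_rcons _ _ _) Jxs.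
have [ysJ yJ] := proj1 (regseq_rcons _ _ _) Jys.
have [Q|z mz zP] := @common_nonzerodiv A m (List.app (chain J xs) (chain J ys)) noethA im.
  move/(List.in_app_or (chain J xs) (chain J ys)) => [QJ|QJ].
    by split; [exact: chain_ideal QJ | exact: (chain_socle xsm Jxs)].
  by split; [exact: chain_ideal QJ | exact: (chain_socle ysm Jys)].
have zxs Q : List.In Q (chain J xs) -> nonzerodiv Q z.
  by move=> QJ; apply: zP; apply: List.in_or_app; left.
have zys Q : List.In Q (chain J ys) -> nonzerodiv Q z.
  by move=> QJ; apply: zP; apply: List.in_or_app; right.
have last_chain l : List.In (foldl addI J l) (chain J l).
  by elim: (l) (J) => [|u l' IHl] J' /=; [left | right; apply: IHl].
have mx : m x by apply: xsm; rewrite mem_rcons inE eqxx.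
have my : m y by apply: ysm; rewrite mem_rcons inE eqxx.
have ixs := foldl_addI_ideal xs iJ; have iys := foldl_addI_ideal ys iJ.
have xz t : socle_free (foldl addI J (rcons xs x)) t -> socle_free (foldl addI (addI J z) xs) t.
  by rewrite foldl_rcons foldl_addIC; apply: socle_free_exchange => //; apply: zxs.
have yz t : socle_free (foldl addI J (rcons ys y)) t -> socle_free (foldl addI (addI J z) ys) t.
  by rewrite foldl_rcons foldl_addIC; apply: socle_free_exchange => //; apply: zys.
have zy t : socle_free (foldl addI (addI J z) ys) t -> socle_free (foldl addI J (rcons ys y)) t.
  by rewrite foldl_rcons foldl_addIC; apply: socle_free_exchange => //; apply: zys.
move=> socx socy t /xz xst; apply/zy; apply: (IH (addI J z) xs ys) => //.
- exact: addI_ideal.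
- by move=> u uxs; apply: xsm; rewrite mem_rcons inE uxs orbT.
- by move=> u uys; apply: ysm; rewrite mem_rcons inE uys orbT.
- exact: regseq_addI.
- exact: regseq_addI.
- exact: xz.
- exact: yz.
Qed.

End SocleDimension.

(** * Polynomial rings are noetherian *)

Section Dickson.
Local Open Scope nat_scope.

Lemma nondecreasing_subsequence (f : nat -> nat) :
  exists phi : nat -> nat, {homo phi : i j / i < j} /\ {homo f \o phi : i j / i <= j}.
Proof.
have next k : {j | k <= j /\ forall i, k <= i -> f j <= f i}.
  apply: constructive_indefinite_description; apply: NNPP => nj.
  suff nf b i : k <= i -> f i < b -> False by apply: (nf (f k).+1 k).
  elim: b i => // b IH i ki fib; apply: nj; exists i; split=> // i' ki'.
  rewrite leqNgt; apply/negP => fi'i; apply: (IH i' ki'); exact: leq_trans fi'i _.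
pose phi := fix phi i := if i is j.+1 then sval (next (phi j).+1) else sval (next 0).
have phiS i : phi i < phi i.+1 by rewrite /=; case: (next _) => j [].
have phi_lt : {homo phi : i j / i < j} by apply: homo_ltn => //; apply: ltn_trans.
exists phi; split=> //; apply: homo_leq => [//|? ? ?|i]; first exact: leq_trans.
have min_at j : forall k, phi j <= k -> f (phi j) <= f k.
  case: j => [|j] k /=; case: (next _) => l [lb lmin] /= lk.
    exact: lmin.
  by apply: lmin; apply: leq_trans lb lk.
by apply: min_at; apply: ltnW.
Qed.

(** Nondecreasing subsequences are extracted for one coordinate after another; the first two terms
    of the last one are comparable. *)
Lemma dickson n (f : nat -> 'X_{1..n}) : exists i j, i < j /\ (f i <= f j)%MM.
Proof.
suff coords k : k <= n -> exists phi : nat -> nat, {homo phi : i j / i < j} /\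
    forall l : 'I_n, l < k -> {homo (fun i => f (phi i) l) : i j / i <= j}.
  have [phi [phi_lt phi_le]] := coords n (leqnn n).
  by exists (phi 0), (phi 1); split; [apply: phi_lt | apply/mnm_lepP => l; apply: phi_le].
elim: k => [_|k IH kn]; first by exists id; split.
have [phi [phi_lt phi_le]] := IH (ltnW kn).
have [psi [psi_lt psi_le]] := nondecreasing_subsequence (fun i => f (phi i) (Ordinal kn)).
exists (phi \o psi); split=> [i j ij|l]; first exact/phi_lt/psi_lt.
rewrite ltnS leq_eqVlt => /predU1P[lk|lk] i j ij.
  have -> : l = Ordinal kn by apply: val_inj.
  exact: psi_le.
apply: (phi_le l lk); move: ij; rewrite leq_eqVlt => /predU1P[->//|ij].
exact/ltnW/psi_lt.
Qed.
End Dickson.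

(* The step polynomials [f i] in [Js i.+1] but not in [Js i] are chosen with smallest leading monomial;
   a divisibility between two leading monomials then gives a smaller one. *)
Theorem noetherian_mpoly (K : fieldType) n : noetherian {mpoly K[n]}.
Proof.
move=> Js iJs Jsub; apply: NNPP => nstab.
have Jmono i j a : (i <= j)%N -> Js i a -> Js j a.
  by move/subnK <-; elim: (j - i)%N => // k IH /IH /Jsub.
have new i : {f | [/\ Js i.+1 f, ~ Js i f &
    forall g, (mlead g < mlead f)%O -> Js i.+1 g -> Js i g]}.
  apply: constructive_indefinite_description; apply: NNPP => nf.
  have nJ : forall a, ~ (Js i.+1 a /\ ~ Js i a).
    move=> a; move: {2}(mlead a) (erefl (mlead a)) => m; move: m a.
    apply: (well_founded_induction (@ltom_wf n)) => m IH a am [Ja nJa].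
    apply: nf; exists a; split=> // g ga Jg; apply: NNPP => nJg.
    by apply: (IH (mlead g)) (erefl _) _ => //; rewrite -am.
  by apply: nstab; exists i => a Ja; apply: NNPP => nJa; apply: (nJ a).
pose f i := sval (new i).
have [i [j [ij dvd_ij]]] := dickson (fun i => mlead (f i)).
have [Jfi nJfi _] := svalP (new i); have [Jfj nJfj fjmin] := svalP (new j).
rewrite -/(f i) -/(f j) in Jfi nJfi Jfj nJfj fjmin.
have [J0 JD JM] := iJs j.
have fi0 : f i != 0 by apply/eqP => fi0; apply: nJfi; rewrite fi0; case: (iJs i).
have fj0 : f j != 0 by apply/eqP => fj0; apply: nJfj; rewrite fj0.
(* [q] is the multiple of [f i] with the leading term of [f j]. It lies in [Js j], so [f j - q] is
   still a step polynomial, with a smaller leading monomial. *)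
pose q := ((mleadc (f j) / mleadc (f i)) *: 'X_[mlead (f j) - mlead (f i)]) * f i.
have Jq : Js j q by apply: JM; apply: Jmono Jfi.
have cfi : mleadc (f i) != 0 by rewrite mleadc_eq0.
have cfj : mleadc (f j) != 0 by rewrite mleadc_eq0.
have c0 : mleadc (f j) / mleadc (f i) != 0 by rewrite mulf_neq0 ?invr_eq0.
have X0 : 'X_[mlead (f j) - mlead (f i)] != 0 :> {mpoly K[n]}.
  by rewrite -mleadc_eq0 mleadXm mcoeffX eqxx oner_eq0.
have ltq : mlead q = mlead (f j).
  by rewrite /q -scalerAl (mleadZ _ c0) (mleadM X0 fi0) mleadXm submK.
have lcq : mleadc q = mleadc (f j).
  rewrite /q -scalerAl mleadcZE (mleadM X0 fi0) mleadcM mleadXm mcoeffX eqxx mul1r.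
  by rewrite divfK.
have Jfjq : ~ Js j (f j - q) by move/(ideal_subl (iJs j)); apply: (fun H => nJfj (H Jq)).
have d0 : f j - q != 0 by apply/eqP => d0; apply: Jfjq; rewrite d0.
apply: Jfjq; apply: fjmin; last by apply: idealB => //; apply: Jsub.
rewrite lt_neqAle; apply/andP; split.
  apply/eqP => E; have := mlead_supp d0; rewrite E mcoeff_msupp mcoeffB.
  by rewrite -{2}ltq lcq subrr eqxx.
by have := mleadB_le (f j) q; rewrite ltq joinxx.
Qed.

(** * Unmixed balanced forests *)

Section Graph.
Local Open Scope nat_scope.
Variables (n : nat) (e : rel 'I_n).
Hypothesis fore : forest e.
Implicit Types (u v w x y z : 'I_n) (D : {set 'I_n}).

Let sym_e : ssrbool.symmetric e. Proof. by case: fore => [[]]. Qed.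
Let eirr : irreflexive e. Proof. by case: fore => [[]]. Qed.

Lemma edge_neq u v : e u v -> u != v.
Proof. by apply: contraTneq => ->; rewrite eirr. Qed.

Lemma in_nbhdS v D : (v \in nbhdS e D) = [exists d in D, e d v].
Proof.
apply/bigcupP/exists_inP => -[d dD]; first by rewrite inE; exists d.
by exists d; rewrite ?inE.
Qed.

(** Paths grow at the head. If [z] lay on [p], the path up to [z] and the edge from [z] to [x] would
    form a cycle, of length at least three since [z != y]. *)
Lemma forest_extend x y z p : path e x (y :: p) -> uniq (x :: y :: p) ->
  e z x -> z != y -> z \notin x :: y :: p.
Proof.
move=> ep up ezx zy; rewrite 2!inE (negbTE (edge_neq ezx)) (negbTE zy) /=.
apply/negP => zp; case/splitPr: zp ep up => p1 p2 ep up.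
case: fore => _ /(_ (z :: x :: y :: p1)) acyc; apply/negP: isT; apply/negP.
have /acyc : uniq (z :: x :: y :: p1).
  move: up; rewrite -!cat_cons cat_uniq => /and3P[up1 + _].
  by rewrite (cons_uniq z) up1 andbT /= negb_or => /andP[].
move=> /(_ isT); rewrite /cycle rcons_path /= ezx /= => /negP[].
by move: ep; rewrite /= cat_path /= => /and3P[-> -> /andP[-> _]].
Qed.

Lemma forest_no_square v w x y : v != w -> x != y ->
  e v x -> e v y -> e w x -> e w y -> False.
Proof.
move=> vw xy evx evy ewx ewy.
have p1 : path e v [:: x] by rewrite /= evx.
have u1 : uniq [:: v; x] by rewrite /= inE edge_neq.
have eyv : e y v by rewrite sym_e.
have p2 : path e y [:: v; x] by rewrite /= eyv.
have u2 : uniq [:: y; v; x].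
  by rewrite cons_uniq u1 andbT; apply: forest_extend p1 u1 eyv _; rewrite eq_sym.
have p3 : path e w [:: y; v; x] by rewrite /= ewy.
have u3 : uniq [:: w; y; v; x].
  by rewrite cons_uniq u2 andbT; apply: forest_extend p2 u2 ewy _; rewrite eq_sym.
have exw : e x w by rewrite sym_e.
by have := forest_extend p3 u3 exw xy; rewrite !inE eqxx !orbT.
Qed.

(* Otherwise [p, a, w1, x, v, y, w2, b] would be an eight-cycle. *)
Lemma forest_no_octagon p a b w1 w2 x y v : a != b -> e p a -> e p b ->
  e a w1 -> e b w2 -> w1 != p -> w2 != p -> e w1 x -> e w2 y -> x != a -> y != b ->
  e v x -> e v y -> x != y -> False.
Proof.
move=> ab epa epb eaw1 ebw2 w1p w2p ew1x ew2y xa yb evx evy xy.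
have p1 : path e w1 [:: x] by rewrite /= ew1x.
have u1 : uniq [:: w1; x] by rewrite /= inE edge_neq.
have p2 : path e a [:: w1; x] by rewrite /= eaw1.
have u2 : uniq [:: a; w1; x].
  by rewrite cons_uniq u1 andbT; apply: forest_extend p1 u1 eaw1 _; rewrite eq_sym.
have p3 : path e p [:: a; w1; x] by rewrite /= epa.
have u3 : uniq [:: p; a; w1; x].
  by rewrite cons_uniq u2 andbT; apply: forest_extend p2 u2 epa _; rewrite eq_sym.
have ebp : e b p by rewrite sym_e.
have p4 : path e b [:: p; a; w1; x] by rewrite /= ebp.
have u4 : uniq [:: b; p; a; w1; x].
  by rewrite cons_uniq u3 andbT; apply: forest_extend p3 u3 ebp _; rewrite eq_sym.
have ew2b : e w2 b by rewrite sym_e.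
have p5 : path e w2 [:: b; p; a; w1; x] by rewrite /= ew2b.
have u5 : uniq [:: w2; b; p; a; w1; x].
  by rewrite cons_uniq u4 andbT; apply: forest_extend p4 u4 ew2b _.
have eyw2 : e y w2 by rewrite sym_e.
have p6 : path e y [:: w2; b; p; a; w1; x] by rewrite /= eyw2.
have u6 : uniq [:: y; w2; b; p; a; w1; x].
  by rewrite cons_uniq u5 andbT; apply: forest_extend p5 u5 eyw2 _.
(* The octagon degenerates when [v] is [w2]: then [x] is adjacent to the head of the path, so it
   must be the next vertex [b], and the path would repeat a vertex. *)
have [vw2|vw2] := eqVneq v w2.
  have exw2 : e x w2 by rewrite sym_e -vw2.
  have := forest_extend p5 u5 exw2; rewrite !inE eqxx !orbT => /implyP.
  rewrite implybF negbK => /eqP xb; move: u5; rewrite xb /= !inE eqxx !orbT.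
  by rewrite /= !andbF.
have p7 : path e v [:: y; w2; b; p; a; w1; x] by rewrite /= evy.
have u7 : uniq [:: v; y; w2; b; p; a; w1; x].
  by rewrite cons_uniq u6 andbT; apply: forest_extend p6 u6 evy vw2.
have exv : e x v by rewrite sym_e.
by have := forest_extend p7 u7 exv xy; rewrite !inE eqxx !orbT.
Qed.

(* Take [v] at the end of a longest alternating path. *)
Lemma forest_extremal (O : {set 'I_n}) v0 : (forall v, v \in O -> exists u, e v u) ->
  v0 \in O -> exists v u, [/\ v \in O, e v u &
    forall v' u', v' \in O -> v' != v -> e v u' -> e v' u' -> u' = u].
Proof.
move=> Onbr v0O; apply: NNPP => noext.
have ext v u : v \in O -> e v u -> exists v' u',
    [/\ v' \in O, v' != v, e v u', e v' u' & u' != u].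
  move=> vO evu; apply: NNPP => nv; apply: noext; exists v, u; split=> // v' u' v'O v'v evu' ev'u'.
  by apply: NNPP => /eqP u'u; apply: nv; exists v', u'.
have long k : exists v u p, [/\ v \in O, path e v (u :: p), uniq (v :: u :: p) & k <= size p].
  elim: k => [|k [v [u [p [vO evp uvp szp]]]]].
    have [u0 e0] := Onbr v0 v0O; exists v0, u0, [::]; split=> //=; first by rewrite e0.
    by rewrite inE edge_neq.
  have evu : e v u by case/andP: evp.
  have [v' [u' [v'O v'v evu' ev'u' u'u]]] := ext v u vO evu.
  have eu'v : e u' v by rewrite sym_e.
  have up' : uniq (u' :: v :: u :: p).
    by rewrite cons_uniq uvp andbT; apply: forest_extend.
  have ep' : path e u' (v :: u :: p) by rewrite /= eu'v.
  exists v', u', (v :: u :: p); split=> //; first by rewrite /= ev'u'.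
    by rewrite cons_uniq up' andbT; apply: forest_extend.
  by rewrite /= ltnS (leq_trans szp).
have [v [u [p [_ _ /card_uniqP up szp]]]] := long n.
have := max_card (mem (v :: u :: p)); rewrite up card_ord /=.
by rewrite ltnNge (leq_trans szp).
Qed.

(** * Packings and transversals of neighborhoods *)

Definition hits_nbhds (O D : {set 'I_n}) := O \subset nbhdS e D.

Lemma hits_nbhdsP (O D : {set 'I_n}) :
  reflect (forall v, v \in O -> exists2 d, d \in D & e v d) (hits_nbhds O D).
Proof.
apply: (iffP subsetP) => OD v /OD; rewrite in_nbhdS.
  by case/exists_inP=> d dD edv; exists d => //; rewrite sym_e.
by case=> d dD evd; apply/exists_inP; exists d => //; rewrite sym_e.
Qed.

(** The extremal vertex [v] enters [P], its neighbor [u] enters [D], and all members of [O] adjacent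
    to [u] are removed. The others share no neighbor with [v], as only [u] could be shared. That [D]
    is adjacent to [O] keeps it in the opposite parity class later. *)
Lemma forest_konig (O : {set 'I_n}) : (forall v, v \in O -> exists u, e v u) ->
  exists P D : {set 'I_n}, [/\ P \subset O, hits_nbhds O D, #|D| <= #|P|,
    forall d, d \in D -> exists2 v, v \in O & e v d &
    forall p q u, p \in P -> q \in P -> e p u -> e q u -> p = q].
Proof.
move: {2}#|O| (leqnn #|O|) => k; elim: k O => [|k IH] O.
  rewrite leqn0 cards_eq0 => /eqP-> _; exists set0, set0; split; rewrite ?cards0 ?sub0set //.
  - by apply/hits_nbhdsP => v; rewrite inE.
  - by move=> d; rewrite inE.
  - by move=> p q u; rewrite inE.
move=> leOk Onbr; have [->|[v0 v0O]] := set_0Vmem O.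
  by apply: IH; rewrite ?cards0 // => v; rewrite inE.
have [v [u [vO evu vext]]] := forest_extremal Onbr v0O.
have vO' : v \notin O :\: nbhd e u by rewrite !inE sym_e evu.
have [||P [D [PO DO leDP Dadj Pdisj]]] := IH (O :\: nbhd e u).
- rewrite -ltnS; apply: leq_trans leOk; apply: proper_card.
  by apply/properP; split; [exact: subsetDl | exists v].
- by move=> w /setDP[wO _]; apply: Onbr.
have vP : v \notin P by apply: contra vO'; apply: (subsetP PO).
exists (v |: P), (u |: D); split.
- by rewrite subUset sub1set vO (subset_trans PO) ?subsetDl.
- apply/hits_nbhdsP => w wO; case: (boolP (e w u)) => [ewu|nwu].
    by exists u; rewrite ?setU11.
  have [|d dD ewd] := hits_nbhdsP _ _ DO w; first by rewrite !inE sym_e nwu.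
  by exists d; rewrite // setU1r.
- rewrite [#|v |: P|]cardsU1 vP add1n; apply: leq_trans (leq_card_setU _ _) _.
  by rewrite cards1 add1n ltnS.
- move=> d /setU1P[->|/Dadj[w /setDP[wO _] ewd]]; first by exists v.
  by exists w.
have disj q w : q \in P -> e v w -> e q w -> False.
  move=> qP evw eqw; have /setDP[qO] := subsetP PO q qP; rewrite inE => /negP; apply.
  have qv : q != v by apply: contraNneq vP => <-.
  by rewrite sym_e -(vext q w).
move=> p q w /setU1P[->|pP] /setU1P[->|qP] //.
- by move=> evw /(disj _ _ qP evw).
- by move=> epw /(disj _ _ pP)/(_ epw).
- exact: Pdisj.
Qed.

Lemma packing_card_le (P D : {set 'I_n}) : hits_nbhds P D ->
  (forall p q u, p \in P -> q \in P -> e p u -> e q u -> p = q) -> #|P| <= #|D|.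
Proof.
move=> /hits_nbhdsP PD Pdisj.
pose f p := odflt p [pick d in D | e p d].
have fP p : p \in P -> f p \in D /\ e p (f p).
  move=> pP; rewrite /f; case: pickP => [d /andP[]//|nd].
  by have [d dD epd] := PD p pP; have := nd d; rewrite dD epd.
rewrite -(card_in_imset (f := f) (D := P)); last first.
  move=> p q pP qP fpq; have [_ epf] := fP p pP; have [_ eqf] := fP q qP.
  by apply: (Pdisj p q (f p)) => //; rewrite fpq.
by apply/subset_leq_card/subsetP => _ /imsetP[p pP ->]; case: (fP p pP).
Qed.

(** * Heights and parity *)

Hypothesis bal : balanced e.

Lemma ball_step v w k u : e w v -> u \in ball e v k -> u \in ball e w k.+1.
Proof.
move=> ewv; elim: k u => [|k IH] u.
  by move=> /set1P->; rewrite !inE in_nbhdS; apply/orP; right; apply/exists_inP; exists w; rewrite ?set11.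
rewrite [ball e v k.+1]/= inE => /orP[/IH uw|]; first by rewrite [ball e w _]/= inE uw.
rewrite in_nbhdS => /exists_inP[x /IH xw exu]; rewrite [ball e w _]/= inE; apply/orP; right.
by rewrite in_nbhdS; apply/exists_inP; exists x.
Qed.

Lemma edge_nbhd v u : e v u -> nbhd e v != set0.
Proof. by move=> evu; apply/set0Pn; exists u; rewrite inE. Qed.

Lemma nbhd_nonempty v : nbhd e v != set0 -> exists u, e v u.
Proof. by case/set0Pn=> u; rewrite inE; exists u. Qed.

Lemma edge_n_gt1 v u : e v u -> 1 < n.
Proof.
move=> /edge_neq vu; have : #|[set v; u]| <= n by rewrite -[n in _ <= n]card_ord max_card.
by rewrite cards2 vu.
Qed.

Lemma height_isolated v : nbhd e v = set0 -> height e v = 0.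
Proof. by rewrite /height => ->; rewrite eqxx. Qed.

Lemma height_le v k l : k < n -> l \in ball e v k -> leaf e l -> height e v <= k.
Proof.
move=> kn lv ll; rewrite /height; case: ifP => // _; rewrite leqNgt; apply/negP.
move/(before_find 0); rewrite nth_iota // add0n => /exists_inP[].
by exists l.
Qed.

Lemma height_leaf v : nbhd e v != set0 -> height e v < n ->
  exists2 l, l \in ball e v (height e v) & leaf e l.
Proof.
move=> v0; have hE : height e v = find (fun k => [exists l in ball e v k, leaf e l]) (iota 0 n).
  by rewrite /height (negbTE v0).
move=> hn; have := hn; rewrite hE -[X in _ < X](size_iota 0 n) -has_find => /(nth_find 0).
by rewrite -hE nth_iota // add0n => /exists_inP.
Qed.

Lemma height_le_n v : height e v <= n.
Proof.
rewrite /height; case: ifP => // _.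
by rewrite -[n in _ <= n](size_iota 0 n) find_size.
Qed.

Lemma height_edge u v : e u v -> height e v <= (height e u).+1.
Proof.
(* A failing [find] on [iota 0 n] returns [n], so heights never exceed [n] and the bound is trivial
   in the second case. *)
move=> euv; case: (ltnP (height e u).+1 n) => [hn|]; last exact/leq_trans/height_le_n.
have [l lu ll] := height_leaf (edge_nbhd euv) (ltnW hn).
by apply: height_le hn _ ll; apply: ball_step lu; rewrite sym_e.
Qed.

Lemma odd_height_edge u v : e u v -> odd (height e u) = ~~ odd (height e v).
Proof.
move=> euv; have evu : e v u by rewrite sym_e.
have := (height_edge euv, height_edge evu, bal euv) => -[[uv vu] neq].
have [->|->] : height e u = (height e v).+1 \/ height e v = (height e u).+1 by lia.
  by [].
by rewrite /= negbK.
Qed.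

Lemma height0P v : reflect (nbhd e v = set0 \/ leaf e v) (height e v == 0).
Proof.
apply: (iffP eqP) => [hv|[/height_isolated//|lv]].
  have [->|v0] := eqVneq (nbhd e v) set0; first by left.
  have [u evu] := nbhd_nonempty v0.
  have [|l] := height_leaf v0; first by rewrite hv ltnW // (edge_n_gt1 evu).
  by rewrite hv => /set1P->; right.
apply/eqP; rewrite -leqn0; apply: (@height_le v 0 v) => //; last exact: set11.
exact: leq_ltn_trans (ltn_ord v).
Qed.

Lemma height1P v : reflect (nbhd e v != set0 /\ ~~ leaf e v /\ exists2 l, e v l & leaf e l)
  (height e v == 1).
Proof.
apply: (iffP eqP) => [hv|[v0 [nlv [l evl ll]]]].
  have v0 : nbhd e v != set0 by apply: contra_eqN hv => /eqP/height_isolated->.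
  have nlv : ~~ leaf e v by apply: contra_eqN hv => lv; apply/eqP => hv; have/height0P := or_intror lv : nbhd e v = set0 \/ _; rewrite hv.
  split=> //; split=> //; have [u evu] := nbhd_nonempty v0.
  have [|l] := height_leaf v0; first by rewrite hv (edge_n_gt1 evu).
  rewrite hv /= !inE => /predU1P[->|]; first by rewrite (negbTE nlv).
  by rewrite in_nbhdS => /exists_inP[_ /set1P-> evl]; exists l.
apply/eqP; rewrite eqn_leq lt0n; apply/andP; split; last first.
  by apply/height0P => -[v00|lv]; [rewrite v00 eqxx in v0 | rewrite lv in nlv].
apply: height_le (edge_n_gt1 evl) _ ll; apply: (@ball_step l v 0) => //; exact: set11.
Qed.

Lemma odd_height_nbhd v : odd (height e v) -> 1 < #|nbhd e v|.
Proof.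
move=> ov; rewrite ltn_neqAle eq_sym card_gt0; apply/andP; split.
  by apply: contraTN ov => lv; have/eqP-> : height e v == 0 by apply/height0P; right.
by apply: contraTN ov => /eqP v0; rewrite height_isolated.
Qed.


Lemma other_neighbor w p : e w p -> ~~ leaf e w -> exists2 x, e w x & x != p.
Proof.
rewrite /leaf (cardsD1 p) inE => -> /=; rewrite add1n eqSS cards_eq0 => /set0Pn[x].
by rewrite !inE => /andP[xp ewx]; exists x.
Qed.

Lemma leaf_neighbor l x y : leaf e l -> e l x -> e l y -> x = y.
Proof.
by case/cards1P=> z lz elx ely; have := (in_set1 x z, in_set1 y z); rewrite -lz !inE elx ely => -[/esym/eqP-> /esym/eqP->].
Qed.

Lemma comp_closed v u w : u \in Defs.comp e v -> e u w -> w \in Defs.comp e v.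
Proof. by rewrite !inE => vu /connect1; apply: connect_trans. Qed.

Lemma comp_nonempty v w : nbhd e v != set0 -> w \in Defs.comp e v -> exists u, e w u.
Proof.
move=> v0; rewrite inE => /connectP[p]; case/lastP: p => [_ ->|p x].
  exact: nbhd_nonempty.
by rewrite rcons_path last_rcons => /andP[_ ex] ->; exists (last v p); rewrite sym_e.
Qed.

Lemma even_neighbor v u : v \in Vodd e -> e v u -> u \in Veven e.
Proof. by rewrite !inE => ov /odd_height_edge; rewrite ov => <-. Qed.

Lemma odd_neighbor v u : v \in Veven e -> e v u -> u \in Vodd e.
Proof. by rewrite !inE => ov /odd_height_edge/(congr1 negb); rewrite ov negbK => <-. Qed.

Lemma VevenP v : (v \in Veven e) = (v \notin Vodd e). Proof. by rewrite !inE. Qed.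

(** * Structure of one unmixed component *)

Hypothesis unm : forall v, unmixed_comp e (Defs.comp e v).

Section Component.
Variable v0 : 'I_n.
Hypothesis v0N : nbhd e v0 != set0.
Let C := Defs.comp e v0.
Let O := Vodd e :&: C.
Let E := Veven e :&: C.
Let tr (D : {set 'I_n}) := (D \subset E) && hits_nbhds O D.

(** Adding to a minimal [D] a fixed minimal odd set [F] that meets all even neighborhoods gives a
    minimal TD-set: the even and odd parts serve disjoint classes of vertices, so neither helps to
    shrink the other. Unmixedness then compares the sums [#|D| + #|F|]. *)
Lemma min_transversal_card D1 D2 : minset tr D1 -> minset tr D2 -> #|D1| = #|D2|.
Proof.
pose dom (F : {set 'I_n}) := (F \subset O) && hits_nbhds E F.
have domO : dom O.
  rewrite /dom subxx; apply/hits_nbhdsP => w /setIP[wE wC].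
  have [u ewu] := comp_nonempty v0N wC; exists u => //.
  by rewrite inE (odd_neighbor wE) // (comp_closed wC).
have [F Fmin _] := minset_exists domO.
have [/andP[FO /hits_nbhdsP EF] minF] := minsetP Fmin.
have minU D : minset tr D -> minset (TDset_of e C) (D :|: F) /\ #|D :|: F| = #|D| + #|F|.
  case/minsetP=> /andP[DE /hits_nbhdsP OD] minD; split.
    apply/minsetP; split.
      apply/andP; split.
        by rewrite subUset (subset_trans DE) ?subsetIr // (subset_trans FO) ?subsetIr.
      apply/subsetP => w wC; rewrite in_nbhdS; apply/exists_inP.
      case: (boolP (w \in Vodd e)) => [wO|]; last rewrite -VevenP => wE.
        have [|d dD ewd] := OD w; first by rewrite inE wO.
        by exists d; [rewrite inE dD | rewrite sym_e].
      have [|d dF ewd] := EF w; first by rewrite inE wE.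
      by exists d; [rewrite inE dF orbT | rewrite sym_e].
    move=> B /andP[BC /subsetP CB] BDF.
    have BE : B :&: Veven e = D.
      apply: minD; last first.
        apply/subsetP => x /setIP[/(subsetP BDF)/setUP[//|xF] xE].
        by have /setIP[xO _] := subsetP FO x xF; rewrite VevenP xO in xE.
      rewrite /tr setIC setIS //=; apply/hits_nbhdsP => w /setIP[wO wC].
      have := CB w wC; rewrite in_nbhdS => /exists_inP[d dB edw].
      have ewd : e w d by rewrite sym_e.
      by exists d => //; rewrite inE dB (even_neighbor wO).
    have BO : B :&: Vodd e = F.
      apply: minF; last first.
        apply/subsetP => x /setIP[/(subsetP BDF)/setUP[xD|//] xO].
        by have /setIP[xE _] := subsetP DE x xD; rewrite VevenP xO in xE.
      rewrite /dom setIC setIS //=; apply/hits_nbhdsP => w /setIP[wE wC].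
      have := CB w wC; rewrite in_nbhdS => /exists_inP[d dB edw].
      have ewd : e w d by rewrite sym_e.
      by exists d => //; rewrite inE dB (odd_neighbor wE).
    by rewrite -BE -BO -setIUr; apply/esym/setIidPl/subsetP => x _; rewrite inE VevenP orNb.
  rewrite cardsU; have -> : D :&: F = set0; last by rewrite cards0 subn0.
  apply/setP => x; rewrite !inE; apply/negP => /andP[/(subsetP DE)/setIP[xE _]].
  by move/(subsetP FO)/setIP=> [xO _]; rewrite VevenP xO in xE.
move=> /minU[m1 c1] /minU[m2 c2]; apply/eqP.
by rewrite -(eqn_add2r #|F|) -c1 -c2; apply/eqP/(unm m1 m2).
Qed.

(** The even vertices off [A] still form a transversal, and a minimal one is extracted inside it. It
    must contain [a] whenever some odd neighborhood lies in [A] apart from [a]. *)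
Lemma min_transversal_avoid (A : {set 'I_n}) :
  (forall v, v \in O -> exists2 x, e v x & x \notin A) ->
  exists D, [/\ minset tr D, hits_nbhds O D &
    forall v a, v \in O -> (forall x, e v x -> x != a -> x \in A) -> a \in D].
Proof.
move=> OA; have trA : tr (E :\: A).
  rewrite /tr subsetDl; apply/hits_nbhdsP => v vO; have [x evx xA] := OA v vO.
  have /setIP[vodd vC] := vO.
  by exists x => //; rewrite in_setD xA in_setI (even_neighbor vodd evx) (comp_closed vC evx).
have [D Dmin DA] := minset_exists trA; exists D.
have [/andP[_ OD] _] := minsetP Dmin; split=> // v a vO vA.
have [d dD evd] := hits_nbhdsP _ _ OD v vO.
have [<- //|da] := eqVneq d a.
by have /setDP[_ /negP[]] := subsetP DA d dD; apply: vA.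
Qed.

Lemma packing_exists : exists P : {set 'I_n}, [/\ P \subset O,
  forall D, minset tr D -> #|D| <= #|P| &
  forall p q u, p \in P -> q \in P -> e p u -> e q u -> p = q].
Proof.
have [v /setIP[_ vC]|P [D [PO OD leDP Dadj Pdisj]]] := @forest_konig O.
  exact: comp_nonempty vC.
exists P; split=> // D1 D1min.
have trD : tr D.
  rewrite /tr OD andbT; apply/subsetP => d /Dadj[v /setIP[vO vC] evd].
  by rewrite inE (even_neighbor vO evd) (comp_closed vC evd).
have [D2 D2min D2D] := minset_exists trD.
by rewrite (min_transversal_card D1min D2min) (leq_trans _ leDP) // subset_leq_card.
Qed.

Lemma neighbor_avoid v w a : v \in O -> v != w -> exists2 x, e v x & x \notin nbhd e w :\ a.
Proof.
move=> vO vw; have /setIP[] := vO; rewrite inE => /odd_height_nbhd /card_gt1P[x [y [+ + xy]]] _.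
rewrite !inE => evx evy.
case: (boolP (e w x)) => [ewx|nx]; last by exists x; rewrite // !inE (negbTE nx) andbF.
exists y => //; rewrite !inE negb_and orbC; apply/orP; left; apply/negP => ewy.
exact: (forest_no_square vw xy evx evy).
Qed.

(** Avoiding the other neighbors of some [v] adjacent to [w] forces [w] into [D]. If no member of
    [P] were adjacent to [w], then [D] without [w] would still hit the packing, so [D] would be too
    large. *)
Lemma packing_covers (P : {set 'I_n}) w : P \subset O ->
  (forall D, minset tr D -> #|D| <= #|P|) ->
  (forall p q u, p \in P -> q \in P -> e p u -> e q u -> p = q) ->
  w \in E -> exists2 p, p \in P & e p w.
Proof.
move=> PO Pmax Pdisj /setIP[wE wC]; have [v ewv] := comp_nonempty v0N wC.
have evw : e v w by rewrite sym_e.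
have vO : v \in O by rewrite inE (odd_neighbor wE) // (comp_closed wC).
have [v' v'O|D [Dmin OD Dmem]] := @min_transversal_avoid (nbhd e v :\ w).
  have [->|v'v] := eqVneq v' v; first by exists w; rewrite // !inE eqxx.
  exact: neighbor_avoid.
have wD : w \in D by apply: (Dmem v) => // x evx xw; rewrite !inE xw.
apply: NNPP => nP; have := Pmax D Dmin; rewrite leqNgt => /negP; apply.
apply: (@leq_ltn_trans #|D :\ w|); last by rewrite [#|D|](cardsD1 w) wD.
apply: packing_card_le => //; apply/hits_nbhdsP => p pP.
have [d dD epd] := hits_nbhdsP _ _ OD p (subsetP PO p pP).
exists d => //; rewrite !inE dD andbT; apply/eqP => dw; apply: nP.
by exists p; rewrite -?dw.
Qed.

(** Take neighbors [w1] of [a] and [w2] of [b] other than [p]; avoiding their remaining neighbors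
    forces both [a] and [b] into [D]. Then [D] without [a] still hits the packing, so [D] is too
    large. An odd neighborhood inside [A] would produce a four-cycle or an eight-cycle. *)
Lemma packing_nonleaf (P : {set 'I_n}) p a b : P \subset O ->
  (forall D, minset tr D -> #|D| <= #|P|) ->
  (forall p q u, p \in P -> q \in P -> e p u -> e q u -> p = q) ->
  p \in P -> e p a -> e p b -> ~~ leaf e a -> ~~ leaf e b -> a = b.
Proof.
move=> PO Pmax Pdisj pP epa epb nla nlb; apply/eqP; apply: contraT => ab.
have pO := subsetP PO p pP; have /setIP[podd pC] := pO.
have eap : e a p by rewrite sym_e.
have ebp : e b p by rewrite sym_e.
have [w1 eaw1 w1p] := other_neighbor eap nla.
have [w2 ebw2 w2p] := other_neighbor ebp nlb.
have ew1a : e w1 a by rewrite sym_e.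
have ew2b : e w2 b by rewrite sym_e.
have w1O : w1 \in O.
  by rewrite inE (odd_neighbor (even_neighbor podd epa)) // (comp_closed (comp_closed pC epa)).
have w2O : w2 \in O.
  by rewrite inE (odd_neighbor (even_neighbor podd epb)) // (comp_closed (comp_closed pC epb)).
pose A := (nbhd e w1 :\ a) :|: (nbhd e w2 :\ b).
have aA : a \notin A.
  rewrite !inE eqxx /= negb_and; apply/orP; right; apply/negP => ew2a.
  exact: (forest_no_square w2p ab ew2a ew2b).
have bA : b \notin A.
  rewrite !inE eqxx /= orbF negb_and; apply/orP; right; apply/negP => ew1b.
  exact: (forest_no_square w1p ab ew1a ew1b).
have [v vO|D [Dmin OD Dmem]] := @min_transversal_avoid A.
  have [->|vw1] := eqVneq v w1; first by exists a.
  have [->|vw2] := eqVneq v w2; first by exists b.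
  have /setIP[] := vO; rewrite inE => /odd_height_nbhd /card_gt1P[x [y [+ + xy]]] _.
  rewrite !inE => evx evy; case: (boolP (x \in A)) => [xA|]; last by exists x.
  case: (boolP (y \in A)) => [yA|]; last by exists y.
  move: xA yA; rewrite !inE => /orP[] /andP[xab ewx] /orP[] /andP[yab ewy]; exfalso.
  - exact: (forest_no_square vw1 xy evx evy).
  - exact: (forest_no_octagon ab epa epb eaw1 ebw2 w1p w2p ewx ewy xab yab evx evy xy).
  - rewrite eq_sym in xy.
    exact: (forest_no_octagon ab epa epb eaw1 ebw2 w1p w2p ewy ewx yab xab evy evx xy).
  - exact: (forest_no_square vw2 xy evx evy).
have aD : a \in D by apply: (Dmem w1) => // x ewx xa; rewrite !inE xa ewx.
have bD : b \in D by apply: (Dmem w2) => // x ewx xb; rewrite !inE xb ewx orbT.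
have := Pmax D Dmin; rewrite leqNgt => /negP[].
apply: (@leq_ltn_trans #|D :\ a|); last by rewrite [#|D|](cardsD1 a) aD.
apply: packing_card_le => //; apply/hits_nbhdsP => q qP.
have [qp|qp] := eqVneq q p; first by exists b; rewrite ?qp // !inE eq_sym ab.
have [d dD eqd] := hits_nbhdsP _ _ OD q (subsetP PO q qP).
exists d => //; rewrite !inE dD andbT; apply: contraNneq qp => da.
by apply/eqP; apply: (Pdisj q p a) => //; rewrite -da.
Qed.

(** A member of the packing has at least two neighbors and at most one non-leaf among them, hence a
    leaf, so its height is 1. Conversely a leaf next to a height-1 vertex is covered by the packing
    and has no other neighbor. *)
Lemma component_structure : exists P : {set 'I_n}, [/\
  forall s, s \in C -> (s \in P) = (height e s == 1),
  forall w, w \in E -> exists2 p, p \in P & e p w,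
  forall p q u, p \in P -> q \in P -> e p u -> e q u -> p = q &
  forall p a b, p \in P -> e p a -> e p b -> ~~ leaf e a -> ~~ leaf e b -> a = b].
Proof.
have [P [PO Pmax Pdisj]] := packing_exists; exists P; split=> //.
- move=> s sC; apply/idP/idP => [sP|/height1P[s0 [nls [l esl ll]]]].
    have /setIP[sodd _] := subsetP PO s sP; rewrite inE in sodd.
    apply/height1P; have := odd_height_nbhd sodd; rewrite /leaf => sgt.
    rewrite -card_gt0 neq_ltn sgt orbT (ltnW sgt); split=> //; split=> //.
    have /card_gt1P[a [b [+ + ab]]] := sgt; rewrite !inE => esa esb.
    case: (boolP (leaf e a)) => la; first by exists a.
    case: (boolP (leaf e b)) => lb; first by exists b.
    by rewrite (packing_nonleaf PO Pmax Pdisj sP esa esb la lb) eqxx in ab.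
  have lE : l \in E.
    rewrite inE (comp_closed sC esl) andbT inE.
    by have/eqP-> : height e l == 0 by apply/height0P; right.
  have [p pP epl] := packing_covers PO Pmax Pdisj lE.
  by rewrite (leaf_neighbor ll (x := s) (y := p)) // sym_e.
- by move=> w; apply: packing_covers.
- by move=> p a b; apply: packing_nonleaf.
Qed.

End Component.

Lemma support_exists w : w \in Veven e -> nbhd e w != set0 -> exists2 s, e s w & height e s = 1.
Proof.
move=> wE w0; have [P [Ph Pcov _ _]] := component_structure w0.
have wC : w \in Defs.comp e w by rewrite inE.
have [|s sP esw] := Pcov w; first by rewrite inE wE.
exists s => //; apply/eqP; rewrite -Ph //; apply: comp_closed wC _.
by rewrite sym_e.
Qed.

Lemma support_unique w s s' : e s w -> e s' w -> height e s = 1 -> height e s' = 1 -> s = s'.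
Proof.
move=> esw es'w hs hs'; have [P [Ph _ Pdisj _]] := component_structure (edge_nbhd esw).
have sC : s \in Defs.comp e s by rewrite inE.
have wC := comp_closed sC esw.
apply: (Pdisj s s' w) => //; rewrite Ph ?hs ?hs' //.
by apply: comp_closed wC _; rewrite sym_e.
Qed.

Lemma support_nonleaf s a b : height e s = 1 -> e s a -> e s b ->
  ~~ leaf e a -> ~~ leaf e b -> a = b.
Proof.
move=> hs esa; have [P [Ph _ _ Pnl]] := component_structure (edge_nbhd esa).
by apply: Pnl => //; rewrite Ph ?hs // inE.
Qed.

Lemma height2_nonleaf w : w \in Veven e -> nbhd e w != set0 -> ~~ leaf e w -> height e w = 2.
Proof.
move=> wE w0 nlw; have [s esw hs] := support_exists wE w0.
have := height_edge esw; rewrite hs => wle.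
have : height e w != 0 by apply/height0P => -[w00|lw]; [rewrite w00 eqxx in w0 | rewrite lw in nlw].
by move: wE; rewrite inE; case: (height e w) wle => [|[|[]]].
Qed.

Lemma height3 v : v \in Vodd e -> height e v != 1 -> height e v = 3.
Proof.
move=> vO v1; have vodd := vO; rewrite inE in vodd.
have /card_gt1P[x [_ [+ _ _]]] := odd_height_nbhd vodd; rewrite inE => evx.
have xE := even_neighbor vO evx.
have exv : e x v by rewrite sym_e.
have nlx : ~~ leaf e x.
  apply: contra v1 => lx; apply/height1P; rewrite (edge_nbhd evx); split=> //; split.
    by have := odd_height_nbhd vodd; rewrite /leaf; case: #|_| => [|[]].
  by exists x.
have := height_edge exv; rewrite (height2_nonleaf xE (edge_nbhd exv) nlx).
by case: (height e v) v1 vodd => [|[|[|[]]]].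
Qed.

End Graph.

(** * Pivots *)

Section Pivots.
Local Open Scope nat_scope.
Variables (n : nat) (e : rel 'I_n) (rep : 'I_n -> 'I_n).
Hypotheses (ubf : unmixed_balanced_forest e) (grep : good_rep e rep).
Implicit Types (s u v w x l : 'I_n).

Let fore : forest e. Proof. by case: ubf. Qed.
Let bal : balanced e. Proof. by case: ubf. Qed.
Let unm : forall v, unmixed_comp e (Defs.comp e v). Proof. by case: ubf. Qed.
Let sym_e : ssrbool.symmetric e. Proof. by case: fore => [[]]. Qed.

Definition stem w := odflt w [pick s | e s w && (height e s == 1)].

(* The variable to which all variables of [nbhd (stem w)] are identified modulo [Z]. *)
Definition pivot w := odflt (rep w) [pick u | e (stem w) u && ~~ leaf e u].

Definition nonpivot v := (v \in Veven e) && ((nbhd e v == set0) || (pivot v != v)).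

Lemma stemP w : w \in Veven e -> nbhd e w != set0 ->
  e (stem w) w /\ height e (stem w) = 1.
Proof.
move=> wE w0; rewrite /stem; case: pickP => [s /andP[esw /eqP]//|nos].
have [s esw hs] := support_exists fore bal unm wE w0.
by have := nos s; rewrite esw hs eqxx.
Qed.

Lemma nbhd_even v u : v \in Vodd e -> e v u -> u \in Veven e /\ nbhd e u != set0.
Proof.
move=> vO evu; split; first exact: (even_neighbor fore bal vO evu).
by apply: (@edge_nbhd n e u v); rewrite sym_e.
Qed.

Lemma height1_odd s : height e s = 1 -> s \in Vodd e.
Proof. by move=> hs; rewrite inE hs. Qed.

Lemma stemE s w : height e s = 1 -> e s w -> stem w = s.
Proof.
move=> hs esw; have [wE w0] := nbhd_even (height1_odd hs) esw.
have [sw hsw] := stemP wE w0.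
exact: (support_unique fore bal unm sw esw).
Qed.

Lemma odd_nbhd_nonleaf v u : v \in Vodd e -> height e v != 1 -> e v u -> ~~ leaf e u.
Proof.
move=> vO v1 evu; apply: contra v1 => lu; apply/height1P => //.
rewrite (edge_nbhd evu); split=> //; split; last by exists u.
have := vO; rewrite inE => /(odd_height_nbhd fore).
by rewrite /leaf; case: #|_| => [|[]].
Qed.

Lemma star_component s w x : height e s = 1 -> (forall u, e s u -> leaf e u) -> e s w ->
  connect e w x -> x = s \/ e s x.
Proof.
move=> hs sl esw /connectP[p]; move: (or_intror esw : w = s \/ e s w) => {esw}.
elim: p w => [|y p IH] w ws /=; first by move=> _ ->.
case/andP=> ewy; apply: IH; case: ws => [<-|esw]; first by right.
by left; apply: (leaf_neighbor (sl w esw)); rewrite // sym_e.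
Qed.

Lemma star_compheight s w : height e s = 1 -> (forall u, e s u -> leaf e u) -> e s w ->
  compheight e w = 1.
Proof.
move=> hs sl esw; apply/eqP; rewrite eqn_leq; apply/andP; split.
  apply/bigmax_leqP => x; rewrite inE => /(star_component hs sl esw)[->|esx].
    by rewrite hs.
  by have/eqP-> : height e x == 0 by apply/height0P => //; right; apply: sl.
rewrite -{1}hs; apply: (@leq_bigmax_cond _ _ (height e)).
by rewrite inE connect1 // sym_e.
Qed.

(** If the stem has no non-leaf neighbor, the component is a star of height 1, where [good_rep]
    provides a leaf; not being the center, it is adjacent to it. *)
Lemma pivotP w : w \in Veven e -> nbhd e w != set0 -> e (stem w) (pivot w).
Proof.
move=> wE w0; have [esw hs] := stemP wE w0.
rewrite /pivot; case: pickP => [u /andP[]//|nou] /=.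
have sl u : e (stem w) u -> leaf e u.
  by move=> esu; have := nou u; rewrite esu; case: (leaf e u).
have [conn lr] := proj1 grep w (star_compheight hs sl esw).
have [rs|//] := star_component hs sl esw conn.
have /(height1P fore)[_ [/negP[]]] : height e (stem w) == 1 by rewrite hs.
by rewrite -rs.
Qed.

Lemma pivot_const s w w' : height e s = 1 -> e s w -> e s w' -> pivot w = pivot w'.
Proof.
move=> hs esw esw'; rewrite /pivot (stemE hs esw) (stemE hs esw').
suff -> : rep w = rep w' by [].
by apply: (proj2 grep); apply: (connect_trans (connect1 _) (connect1 esw')); rewrite sym_e.
Qed.

Lemma pivot_nonleaf s u w : height e s = 1 -> e s u -> ~~ leaf e u -> e s w -> pivot w = u.
Proof.
move=> hs esu nlu esw; rewrite /pivot (stemE hs esw).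
case: pickP => [x /andP[esx nlx]|/(_ u)]; last by rewrite esu nlu.
exact: (support_nonleaf fore bal unm hs esx esu nlx nlu).
Qed.

(** Neighbors of a height-3 vertex are not leaves, so each is the one non-leaf neighbor of its stem.
    Hence the generators of height-3 vertices are unchanged by the identifications. *)
Lemma pivot_odd v u : v \in Vodd e -> height e v != 1 -> e v u -> pivot u = u.
Proof.
move=> vO v1 evu; have [uE u0] := nbhd_even vO evu; have [su hs] := stemP uE u0.
exact: (pivot_nonleaf hs su (odd_nbhd_nonleaf vO v1 evu) su).
Qed.

Lemma pivotK w : w \in Veven e -> nbhd e w != set0 ->
  [/\ pivot w \in Veven e, nbhd e (pivot w) != set0, stem (pivot w) = stem w &
      pivot (pivot w) = pivot w].
Proof.
move=> wE w0; have [sw hs] := stemP wE w0; have sp := pivotP wE w0.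
have [pE p0] := nbhd_even (height1_odd hs) sp.
split=> //; [exact: stemE | exact: pivot_const hs sp sw].
Qed.

Lemma compheight_ge u w : connect e w u -> height e u <= compheight e w.
Proof. by move=> wu; apply: (@leq_bigmax_cond _ _ (height e)); rewrite inE. Qed.

Lemma height_le3 v : height e v <= 3.
Proof.
case: (boolP (v \in Vodd e)) => [vO|].
  by have [->//|v1] := eqVneq (height e v) 1; rewrite (height3 fore bal unm vO v1).
rewrite -VevenP // => vE; have [v0|v0] := eqVneq (nbhd e v) set0.
  by rewrite height_isolated.
case: (boolP (leaf e v)) => lv; last by rewrite (height2_nonleaf fore bal unm vE v0 lv).
by have/eqP-> : height e v == 0 by apply/height0P => //; right.
Qed.

Lemma leaf_even l : leaf e l -> l \in Veven e /\ nbhd e l != set0.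
Proof.
move=> ll; rewrite inE; have/eqP-> : height e l == 0 by apply/height0P => //; right.
by split=> //; rewrite -card_gt0 (eqP ll).
Qed.

Lemma compheight3 s u : height e s = 1 -> e s u -> ~~ leaf e u -> compheight e s = 3.
Proof.
move=> hs esu nlu; apply/eqP; rewrite eqn_leq; apply/andP; split.
  by apply/bigmax_leqP => x _; apply: height_le3.
have eus : e u s by rewrite sym_e.
have [w euw ws] := other_neighbor eus nlu.
have [uE u0] := nbhd_even (height1_odd hs) esu.
have wO := odd_neighbor fore bal uE euw.
have w1 : height e w != 1.
  apply/eqP => hw; case/eqP: ws; apply: (support_unique fore bal unm (w := u)) => //.
  by rewrite sym_e.
rewrite -(height3 fore bal unm wO w1); apply: compheight_ge.
exact: connect_trans (connect1 esu) (connect1 euw).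
Qed.

Variable K : fieldType.

Definition zvar v : {mpoly K[n]} :=
  (if nbhd e v == set0 then 'X_v else 'X_(pivot v) - 'X_v)%R.

(** A stem with a non-leaf neighbor [u] marks a component of height 3 and has pivot [u]; a stem
    without one is the center of a star, with pivot given by [rep]. *)
Lemma ZsetP p : Zset e rep p <-> exists2 v, nonpivot v & p = zvar v.
Proof.
split=> [[[v [v0 ->]]|[[l [ll cl lr ->]]|[s [u [l [hs [hu [ll [esu [esl [cs ->]]]]]]]]]]]|].
- exists v; rewrite /zvar ?v0 ?eqxx //.
  by rewrite /nonpivot v0 eqxx inE height_isolated.
- have [lE l0] := leaf_even ll; have [sl hs] := stemP lE l0.
  have pl : pivot l = rep l.
    rewrite /pivot; case: pickP => [u /andP[esu nlu]|//].
    have [uE u0] := nbhd_even (height1_odd hs) esu.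
    have : height e u <= compheight e l.
      by apply: compheight_ge; apply: connect_trans (connect1 _) (connect1 esu); rewrite sym_e.
    by rewrite cl (height2_nonleaf fore bal unm uE u0 nlu).
  by exists l; rewrite /zvar /nonpivot ?lE ?(negbTE l0) pl //= eq_sym.
- have [lE l0] := leaf_even ll.
  have nlu : ~~ leaf e u.
    apply/negP => lu; have/eqP : height e u == 0 by apply/height0P => //; right.
    by rewrite hu.
  have pl := pivot_nonleaf hs esu nlu esl.
  exists l; rewrite /zvar /nonpivot ?lE ?(negbTE l0) pl //=.
  by apply: contraNneq nlu => ->.
- case=> v /andP[vE]; rewrite /zvar; have [v0 _ ->|v0 /= pv ->] := eqVneq (nbhd e v) set0.
    by left; exists v.
  have [sv hs] := stemP vE v0; right.
  case: (pickP [pred u | e (stem v) u && ~~ leaf e u]) => [u /andP[esu nlu]|nou].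
    right; have pu := pivot_nonleaf hs esu nlu sv.
    exists (stem v), u, v; split=> //; split.
      have [uE u0] := nbhd_even (height1_odd hs) esu.
      exact: (height2_nonleaf fore bal unm uE u0 nlu).
    split; last by rewrite pu; split=> //; split=> //; split=> //; apply: compheight3 nlu.
    apply: contraT => nlv; case/eqP: pv; rewrite pu.
    exact: (support_nonleaf fore bal unm hs esu sv nlu nlv).
  left; have sl u : e (stem v) u -> leaf e u.
    by move=> esu; have := nou u; rewrite /= esu; case: (leaf e u).
  have pvE : pivot v = rep v by rewrite /pivot; case: pickP => // u /andP[esu]; rewrite sl.
  exists v; split; [exact: sl | exact: (star_compheight hs sl sv) | | by rewrite pvE].
  by rewrite eq_sym -pvE.
Qed.
End Pivots.

(** * Monomial ideals *)

Section Monomials.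
Variables (K : fieldType) (n : nat).
Notation P := {mpoly K[n]}.
Implicit Types (p q f g h : P) (m : 'X_{1..n}) (i j : 'I_n).

Lemma mpoly_ring_ind (Q : P -> Prop) : (forall c, Q c%:MP) -> (forall i, Q 'X_i) ->
  (forall p q, Q p -> Q q -> Q (p + q)) -> (forall p q, Q p -> Q q -> Q (p * q)) ->
  forall p, Q p.
Proof.
move=> QC QX QD QM p; rewrite [p]mpolyE.
have Q1 : Q 1 by rewrite -mpolyC1.
have Q0 : Q 0 by rewrite -mpolyC0.
apply: (big_ind Q) => [//|//|m _]; rewrite -mul_mpolyC mpolyXE_id; apply: (QM) => //.
apply: (big_ind Q) => [//|//|i _]; elim: (m i) => [|k IH]; first by rewrite expr0.
by rewrite exprS; apply: QM.
Qed.

Lemma comp_mpolyXi i (t : n.-tuple P) : 'X_i \mPo t = tnth t i.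
Proof. by rewrite comp_mpolyXU (tnth_nth 0). Qed.

(** With [V] the even vertices this unfolds to [inR]; with [V] the pivots it describes the
    polynomials left modulo [Z]. *)
Definition supported (V : pred 'I_n) p :=
  forall m, m \in msupp p -> forall i, (0 < m i)%N -> V i.

Section Supported.
Variable V : pred 'I_n.

Lemma supportedC c : supported V c%:MP.
Proof.
move=> m; rewrite msuppC; case: eqP => // _; rewrite inE => /eqP-> i.
by rewrite mnm0E.
Qed.

Lemma supported1 : supported V 1.
Proof. by rewrite -mpolyC1; apply: supportedC. Qed.

Lemma supported0 : supported V 0.
Proof. by rewrite -mpolyC0; apply: supportedC. Qed.

Lemma supportedX i : V i -> supported V 'X_i.
Proof. by move=> Vi m; rewrite msuppX inE => /eqP-> j; rewrite mnm1E; case: eqP => // <-. Qed.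

Lemma supportedD p q : supported V p -> supported V q -> supported V (p + q).
Proof.
move=> Vp Vq m /msuppD_le; rewrite mem_cat => /orP[/Vp|/Vq]; exact.
Qed.

Lemma supportedM p q : supported V p -> supported V q -> supported V (p * q).
Proof.
move=> Vp Vq m /msuppM_le/allpairsP[[m1 m2] /= [m1p m2q ->]] i.
by rewrite mnmDE addn_gt0 => /orP[/(Vp _ m1p)|/(Vq _ m2q)].
Qed.

Lemma supportedN p : supported V p -> supported V (- p).
Proof. by move=> Vp m; rewrite (perm_mem (msuppN p)) => /Vp. Qed.

Lemma supportedB p q : supported V p -> supported V q -> supported V (p - q).
Proof. by move=> Vp Vq; apply/supportedD/supportedN. Qed.

Lemma supported_prod (I : Type) (r : seq I) (A : pred I) (F : I -> P) :
  (forall k, A k -> supported V (F k)) -> supported V (\prod_(k <- r | A k) F k).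
Proof.
move=> VF; apply: (big_ind (supported V)) => //; first exact: supported1.
exact: supportedM.
Qed.

Lemma supported_comp p (t : n.-tuple P) : (forall i, supported V (tnth t i)) ->
  supported V (p \mPo t).
Proof.
move=> Vt; elim/mpoly_ring_ind: p => [c|i|p q|p q].
- by rewrite comp_mpolyC; apply: supportedC.
- by rewrite comp_mpolyXi.
- by rewrite comp_mpolyD; apply: supportedD.
- by rewrite rmorphM; apply: supportedM.
Qed.

Lemma comp_mpoly_supported (t : n.-tuple P) p : (forall i, V i -> tnth t i = 'X_i) ->
  supported V p -> p \mPo t = p.
Proof.
move=> tV Vp; rewrite comp_mpolyEX [RHS]mpolyE !big_seq; apply: eq_bigr => m mp.
congr (_ *: _); rewrite comp_mpolyX mpolyXE_id; apply: eq_bigr => i _.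
have [->|mi] := posnP (m i); first by rewrite !expr0.
by rewrite tV // (Vp m).
Qed.
End Supported.

Lemma mcoeffXiM i p m : ('X_i * p)@_m = if (0 < m i)%N then p@_(m - U_(i)) else 0.
Proof.
case: ifP => mi.
  have mE : (U_(i) + (m - U_(i)))%MM = m by rewrite addmC submK // lep1mP -lt0n.
  by rewrite -{1}mE mulrC mcoeffMX.
apply: memN_msupp_eq0; apply/negP; rewrite mulrC (perm_mem (msuppMX p U_(i))).
by move=> /mapP[m' _ mE]; move: mi; rewrite mE mnmDE mnm1E eqxx.
Qed.

Variables (I : finType) (V : {set I}) (gen : I -> 'X_{1..n}).

Definition divisible m := [exists v in V, (gen v <= m)%MM].

(** The ideal generated by the monomials of exponents [gen v], through the criterion that a
    polynomial belongs to it exactly when all its monomials do. *)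
Definition monomial_ideal p := forall m, m \in msupp p -> divisible m.

Lemma divisible_le m m' : (m <= m')%MM -> divisible m -> divisible m'.
Proof.
move=> mm' /exists_inP[v vV vm]; apply/exists_inP; exists v => //.
exact: lepm_trans vm mm'.
Qed.

Lemma monomial_is_ideal : is_ideal monomial_ideal.
Proof.
split=> [m|p q Jp Jq m /msuppD_le|p q Jq m /msuppM_le/allpairsP[[m1 m2] /= [m1p m2q ->]]].
- by rewrite msupp0.
- by rewrite mem_cat => /orP[/Jp|/Jq].
- exact: divisible_le (lem_addl _ _) (Jq _ m2q).
Qed.

Lemma monomial_idealX m : divisible m -> monomial_ideal 'X_[m].
Proof. by move=> dm m'; rewrite msuppX inE => /eqP->. Qed.

Lemma nonzerodiv_var i : (forall v, v \in V -> gen v i = 0%N) ->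
  nonzerodiv monomial_ideal 'X_i.
Proof.
move=> gi f Jf m mf; have : divisible (m + U_(i)).
  apply: Jf; rewrite mcoeff_msupp mcoeffXiM mnmDE mnm1E eqxx addn1 ltnS leq0n addmK.
  by rewrite -mcoeff_msupp.
case/exists_inP=> v vV /mnm_lepP vm; apply/exists_inP; exists v => //; apply/mnm_lepP => j.
have := vm j; rewrite mnmDE mnm1E; case: eqP => [<- _|_]; first by rewrite gi.
by rewrite addn0.
Qed.

(* If [m] is outside the ideal and [m i < a] then so is [m + U_(j)], otherwise so is [m + U_(i)]; either
   way the coefficient of the product there moves the support of [f] until it leaves the orthant. *)
Lemma nonzerodiv_diff i j a : i != j -> (forall v, v \in V -> (gen v i <= a)%N) ->
  (forall v, v \in V -> (0 < gen v j)%N -> (a <= gen v i)%N) ->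
  nonzerodiv monomial_ideal ('X_i - 'X_j).
Proof.
move=> ij gi gj f Jf.
have coefE m : ~~ divisible m ->
    (if (0 < m i)%N then f@_(m - U_(i)) else 0) = (if (0 < m j)%N then f@_(m - U_(j)) else 0).
  move=> ndm; apply/eqP; rewrite -subr_eq0 -!mcoeffXiM -mcoeffB -mulrBl mcoeff_eq0.
  by apply: contra ndm => /Jf.
have Uji : (U_(j)%MM : 'X_{1..n}) i = 0%N by rewrite mnm1E eq_sym (negbTE ij).
have Uij : (U_(i)%MM : 'X_{1..n}) j = 0%N by rewrite mnm1E (negbTE ij).
have Uii k : (U_(k)%MM : 'X_{1..n}) k = 1%N by rewrite mnm1E eqxx.
have low k m : m i = k -> (k < a)%N -> m \in msupp f -> divisible m.
  elim: k m => [|k IH] m mk ka mf; apply: contraT => ndm.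
  - have nd' : ~~ divisible (m + U_(j)).
      apply: contra ndm => /exists_inP[v vV /mnm_lepP vm]; apply/exists_inP; exists v => //.
      apply/mnm_lepP => l; have := vm l; rewrite mnmDE mnm1E; case: eqP => [<- _|_]; last by rewrite addn0.
      case: (posnP (gen v j)) => [->//|/(gj v vV)]; have := vm i.
      by rewrite mnmDE Uji; lia.
    have := coefE _ nd'; rewrite !mnmDE Uji Uii mk /= addn1 /= addmK => /esym/eqP.
    by rewrite mcoeff_eq0 mf.
  - have nd' : ~~ divisible (m + U_(j)).
      apply: contra ndm => /exists_inP[v vV /mnm_lepP vm]; apply/exists_inP; exists v => //.
      apply/mnm_lepP => l; have := vm l; rewrite mnmDE mnm1E; case: eqP => [<- _|_]; last by rewrite addn0.
      case: (posnP (gen v j)) => [->//|/(gj v vV)]; have := vm i.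
      by rewrite mnmDE Uji; lia.
    have := coefE _ nd'; rewrite !mnmDE Uji Uii mk /= addn1 ?addn0 /= addmK => cf.
    case/negP: nd'; apply: divisible_le (lem_subr _ U_(i)) (IH _ _ (ltnW ka) _).
      by rewrite mnmBE mnmDE Uji Uii mk addn0 subn1.
    by rewrite mcoeff_msupp cf -mcoeff_msupp.
have high k m : m j = k -> (a <= m i)%N -> m \in msupp f -> divisible m.
  elim: k m => [|k IH] m mk am mf; apply: contraT => ndm.
  - have nd' : ~~ divisible (m + U_(i)).
      apply: contra ndm => /exists_inP[v vV /mnm_lepP vm]; apply/exists_inP; exists v => //.
      apply/mnm_lepP => l; have := vm l; rewrite mnmDE mnm1E; case: eqP => [<- _|_]; last by rewrite addn0.
      exact: leq_trans (gi v vV) am.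
    have := coefE _ nd'; rewrite !mnmDE Uij Uii mk addn1 /= addmK => /eqP.
    by rewrite mcoeff_eq0 mf.
  - have nd' : ~~ divisible (m + U_(i)).
      apply: contra ndm => /exists_inP[v vV /mnm_lepP vm]; apply/exists_inP; exists v => //.
      apply/mnm_lepP => l; have := vm l; rewrite mnmDE mnm1E; case: eqP => [<- _|_]; last by rewrite addn0.
      exact: leq_trans (gi v vV) am.
    have := coefE _ nd'; rewrite !mnmDE Uij Uii mk /= addn1 ?addn0 /= addmK => cf.
    case/negP: nd'; apply: divisible_le (lem_subr _ U_(j)) (IH _ _ _ _).
    + by rewrite mnmBE mnmDE Uij Uii mk addn0 subn1.
    + by rewrite mnmBE mnmDE Uji Uii subn0 (leq_trans am) // leq_addr.
    + by rewrite mcoeff_msupp -cf -mcoeff_msupp.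
move=> m mf; case: (ltnP (m i) a) => [ma|am]; first exact: low ma mf.
exact: high am mf.
Qed.

End Monomials.

Arguments supported0 {K n V}.
Arguments supported1 {K n V}.
Arguments supportedC {K n V} c.

(** * The ring of even variables *)

Section EvenRing.
Variables (K : fieldType) (n : nat) (e : rel 'I_n).
Notation P := {mpoly K[n]}.
Notation E := (mem (Veven e)).
Implicit Types (p q f g h x y z : P) (G : P -> Prop) (i v : 'I_n) (xs ys : seq P).

Definition even_part p : P := p \mPo [tuple (if i \in Veven e then 'X_i else 0) | i < n].

Lemma even_part_inR p : inR e (even_part p).
Proof.
apply: (supported_comp (V := E)) => i; rewrite tnth_mktuple; case: ifP => [iE|_].
  exact: supportedX.
exact: supported0.
Qed.

Arguments even_part_inR p : clear implicits.

Lemma even_part_id p : inR e p -> even_part p = p.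
Proof. by apply: comp_mpoly_supported => i iE; rewrite tnth_mktuple ifT. Qed.

Lemma even_partM : {morph even_part : p q / p * q}. Proof. exact: rmorphM. Qed.
Lemma even_partD : {morph even_part : p q / p + q}. Proof. exact: rmorphD. Qed.
Lemma even_partB : {morph even_part : p q / p - q}. Proof. exact: rmorphB. Qed.
Lemma even_part0 : even_part 0 = 0. Proof. exact: rmorph0. Qed.

Lemma inRZ (c : K) p : inR e p -> inR e (c *: p).
Proof. by rewrite -mul_mpolyC; apply: (supportedM (V := E)); apply: supportedC. Qed.

Lemma ideal_gen_mem G g : G g -> ideal_gen e G g.
Proof.
exists [:: (1, g)]; rewrite big_seq1 mul1r; split=> // rg; rewrite inE => /eqP-> /=.
by split=> //; apply: (supported1 (V := E)).
Qed.

Lemma ideal_gen0 G : ideal_gen e G 0.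
Proof. by exists [::]; rewrite big_nil. Qed.

Lemma ideal_genD G f g : ideal_gen e G f -> ideal_gen e G g -> ideal_gen e G (f + g).
Proof.
move=> [s [sG ->]] [t [tG ->]]; exists (s ++ t); rewrite big_cat; split=> // rg.
by rewrite mem_cat => /orP[/sG|/tG].
Qed.

Lemma ideal_genM G r f : inR e r -> ideal_gen e G f -> ideal_gen e G (r * f).
Proof.
move=> Rr [s [sG ->]]; exists [seq (r * rg.1, rg.2) | rg <- s]; split.
  move=> _ /mapP[rg /sG[Rrg Grg] ->]; split=> //=.
  exact: (supportedM (V := E)).
by rewrite big_map mulr_sumr; apply: eq_bigr => rg _; rewrite mulrA.
Qed.

Lemma ideal_gen_le G (J : P -> Prop) f : is_ideal J -> (forall g, G g -> J g) ->
  ideal_gen e G f -> J f.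
Proof.
move=> iJ GJ [s [sG ->]]; apply: ideal_sum => // rg /sG[_ /GJ].
by case: iJ => _ _; apply.
Qed.

(* The ideal of the full polynomial ring generated by [G] and the odd variables: passing to it turns
   questions on the subring [R] into questions on the ring [P]. *)
Definition extended G f := ideal_gen e G (even_part f).

Lemma extended_ideal G : is_ideal (extended G).
Proof.
split=> [|f g|f g]; rewrite /extended.
- by rewrite even_part0; apply: ideal_gen0.
- by rewrite even_partD; apply: ideal_genD.
- by rewrite even_partM; apply: ideal_genM; apply: even_part_inR.
Qed.

Lemma extendedE G f : inR e f -> extended G f = ideal_gen e G f.
Proof. by move=> Rf; rewrite /extended even_part_id. Qed.

Lemma extended_even_part G f : extended G (f - even_part f).
Proof.
rewrite /extended even_partB (even_part_id (even_part_inR f)) subrr.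
exact: ideal_gen0.
Qed.

Lemma extended_odd G v : v \notin Veven e -> extended G 'X_v.
Proof.
move=> vO; rewrite /extended /even_part comp_mpolyXi tnth_mktuple ifN //.
exact: ideal_gen0.
Qed.

Lemma extended_mem G g : inR e g -> G g -> extended G g.
Proof. by move=> Rg Gg; rewrite extendedE //; apply: ideal_gen_mem. Qed.

Lemma extended_le G (J : P -> Prop) f : is_ideal J -> (forall g, J (g - even_part g)) ->
  (forall g, G g -> J g) -> extended G f -> J f.
Proof.
by move=> iJ Jev GJ Gf; apply: (ideal_subl iJ (Jev f)); apply: ideal_gen_le Gf.
Qed.

Lemma regular_onE G x : inR e x -> regular_on e G x <-> nonzerodiv (extended G) x.
Proof.
move=> Rx; split=> [[_ regx] f|regx].
  by rewrite /extended even_partM (even_part_id Rx); apply: regx; apply: even_part_inR.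
split=> // f Rf xf; rewrite -(extendedE _ Rf); apply: regx.
by rewrite extendedE //; apply: (supportedM (V := E)).
Qed.

(** Odd variables are included: they lie in every [extended G], so they impose nothing on its
    socle. *)
Definition maxideal f := f@_0%MM = 0.

Lemma maxideal_ideal : is_ideal maxideal.
Proof.
split=> [|f g|f g]; rewrite /maxideal; first exact: mcoeff0.
  by rewrite mcoeffD => -> ->; rewrite addr0.
by rewrite (rmorphM (mcoeff 0%MM)) /= => ->; rewrite mulr0.
Qed.

Lemma maxideal_var i : maxideal 'X_i.
Proof. by rewrite /maxideal mcoeffX mnm1_eq0. Qed.

Lemma maxideal_gen (J : P -> Prop) f : is_ideal J -> (forall i, (exists2 m, m \in msupp f & (0 < m i)%N) -> J 'X_i) ->
  maxideal f -> J f.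
Proof.
move=> iJ JX f0; have [J0 JD JM] := iJ; rewrite [f]mpolyE.
apply: ideal_sum => // m mf; rewrite -mul_mpolyC; apply: (JM).
have [i mi] : exists i, (0 < m i)%N.
  apply/existsP; apply: contraT; rewrite negb_exists => /forallP m0.
  have mE : m = 0%MM by apply/mnmP => i; rewrite mnm0E; apply/eqP; rewrite -leqn0 leqNgt.
  by move: mf; rewrite mE mcoeff_msupp f0 eqxx.
have mE : (m - U_(i) + U_(i))%MM = m by rewrite submK // lep1mP -lt0n.
by rewrite -mE mpolyXD; apply: JM; apply: JX; exists m.
Qed.

Lemma even_part_maxideal f : maxideal f -> maxideal (even_part f).
Proof.
have [m0 mD mM] := maxideal_ideal.
apply: (@maxideal_gen (fun f => maxideal (even_part f))) => [|i _].
  split=> [|g h|g h]; first by rewrite even_part0.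
    by rewrite even_partD; apply: mD.
  by rewrite even_partM; apply: mM.
rewrite /even_part comp_mpolyXi tnth_mktuple; case: ifP => // _; exact: maxideal_var.
Qed.

Lemma mgen_maxideal f : ideal_gen e (@mgen n e K) f <-> inR e f /\ maxideal f.
Proof.
split=> [Gf|[Rf f0]].
  split; last by apply: ideal_gen_le Gf; [exact: maxideal_ideal | move=> _ [v [_ ->]]; exact: maxideal_var].
  case: Gf => s [sG ->]; rewrite big_seq; apply: (big_ind (@inR n e K)).
  - exact: (supported0 (V := E)).
  - exact: (supportedD (V := E)).
  - move=> [r g] /sG[/= Rr [v [vE ->]]]; apply: (supportedM (V := E)) => //.
    exact: supportedX.
rewrite -(extendedE _ Rf); apply: maxideal_gen => //; first exact: extended_ideal.
move=> i [m mf mi]; have iE := Rf m mf i mi.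
rewrite extendedE; last exact: (supportedX (V := E)).
by apply: ideal_gen_mem; exists i.
Qed.

Lemma socle_extended G f : (forall v, v \in Veven e -> extended G ('X_v * f)) ->
  socle maxideal (extended G) f.
Proof.
move=> Gf a a0; apply: (@maxideal_gen (colon (extended G) f)) => //.
  exact/colon_ideal/extended_ideal.
move=> i _; rewrite /colon; case: (boolP (i \in Veven e)) => [/Gf//|iO].
by rewrite mulrC; have [_ _] := extended_ideal G; apply; apply: extended_odd.
Qed.

Lemma in_socle_extended G f : in_socle e G f -> socle maxideal (extended G) f.
Proof.
case=> Rf Gf; apply: socle_extended => v vE.
by rewrite extendedE; [apply: Gf | apply: (supportedM (V := E)) => //; apply: supportedX].
Qed.

Lemma extended_in_socle G f : socle maxideal (extended G) f -> in_socle e G (even_part f).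
Proof.
move=> Gf; split=> [|v vE]; first exact: even_part_inR.
have := Gf _ (maxideal_var v); rewrite /extended even_partM even_part_id //.
exact: (supportedX (V := E)).
Qed.

Lemma socle_freeP G t :
  socle_free maxideal (extended G) t <-> exists fs, size fs = t /\ socle_indep e G fs.
Proof.
have inRsum (fs : seq P) (c : seq K) (F : nat -> P) k : (forall j : nat, (j < k)%N -> inR e (F j)) ->
    inR e (\sum_(i < k) c`_i *: F i).
  move=> RF; apply: (big_ind (@inR n e K)); [exact: (supported0 (V := E)) | exact: (supportedD (V := E))|].
  by move=> i _; apply: inRZ; apply: RF.
split=> [[fs [szfs fsm fsfree]]|[fs [szfs [fsm fsfree]]]].
  exists (map even_part fs); rewrite size_map szfs; split=> //; split.
    by move=> _ /mapP[f /fsm fs_f ->]; apply: extended_in_socle.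
  rewrite size_map szfs => c szc Gc; apply: fsfree => //; rewrite /extended.
  suff -> : even_part (\sum_(i < t) c`_i *: fs`_i) = \sum_(i < t) c`_i *: (map even_part fs)`_i by [].
  rewrite /even_part raddf_sum /=; apply: eq_bigr => i _; rewrite comp_mpolyZ.
  by rewrite (nth_map 0) ?szfs.
exists fs; split=> //; first by move=> f /fsm; apply: in_socle_extended.
move=> c szc; rewrite extendedE => [Gc|]; first by apply: fsfree; rewrite szfs.
by apply: inRsum => // i it; have [|] := fsm fs`_i; rewrite ?mem_nth ?szfs.
Qed.

Hypothesis odd_nbr : forall v u, v \in Vodd e -> e v u -> u \in Veven e.

Lemma XU_inR v : v \in Vodd e -> inR e (XU K (nbhd e v)).
Proof.
move=> vO; apply: (supported_prod (V := E)) => i; rewrite inE => evi.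
exact/supportedX/(odd_nbr vO).
Qed.

Notation N0 := (extended (Nplus e [::])).

Lemma Nplus_inR xs g : (forall x, x \in xs -> inR e x) -> Nplus e xs g -> inR e g.
Proof. by move=> Rxs [[v [vO ->]]|/Rxs//]; apply: XU_inR. Qed.

Lemma extended_Nplus xs : (forall x, x \in xs -> inR e x) ->
  extended (Nplus e xs) = foldl addI N0 xs.
Proof.
elim/last_ind: xs => [//|xs x IH] Rxs.
have Rx : inR e x by apply: Rxs; rewrite mem_rcons inE eqxx.
have {}Rxs y : y \in xs -> inR e y by move=> yxs; apply: Rxs; rewrite mem_rcons inE yxs orbT.
rewrite foldl_rcons -(IH Rxs).
have iJ := extended_ideal (Nplus e xs).
apply: functional_extensionality => f; apply: propositional_extensionality; split.
  apply: extended_le; [exact: addI_ideal | by move=> g; apply/addI_incl/extended_even_part|].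
  move=> g [Gg|]; first by apply: addI_incl; apply: extended_mem; [apply: (Nplus_inR Rxs)|]; left.
  rewrite mem_rcons inE => /predU1P[->|gxs]; first exact: addI_self.
  by apply: addI_incl; apply: extended_mem; [apply: Rxs | right].
apply: addI_sub; first exact: extended_ideal.
  move=> g; apply: extended_le; [exact: extended_ideal | exact: extended_even_part|].
  move=> h Gh; apply: extended_mem; first exact: Nplus_inR Gh.
  by case: Gh => [|hxs]; [left | right; rewrite mem_rcons inE hxs orbT].
by apply: extended_mem => //; right; rewrite mem_rcons inE eqxx.
Qed.

Lemma regular_seqE xs : (forall x, x \in xs -> inR e x) ->
  (forall j, (j < size xs)%N -> regular_on e (Nplus e (take j xs)) (nth 0 xs j)) <->
  regseq N0 xs.
Proof.
elim/last_ind: xs => [//|xs x IH] Rxs.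
have Rx : inR e x by apply: Rxs; rewrite mem_rcons inE eqxx.
have {}Rxs y : y \in xs -> inR e y by move=> yxs; apply: Rxs; rewrite mem_rcons inE yxs orbT.
rewrite regseq_rcons -IH // -extended_Nplus // -regular_onE // size_rcons; split=> [regx|[regxs regx] j].
  split=> [j jxs|].
    by have := regx j (ltnW jxs); rewrite nth_rcons jxs -cats1 takel_cat // ltnW.
  by have := regx _ (ltnSn _); rewrite nth_rcons ltnn eqxx -cats1 take_size_cat.
rewrite ltnS leq_eqVlt => /predU1P[->|jxs].
  by rewrite nth_rcons ltnn eqxx -cats1 take_size_cat.
by rewrite nth_rcons jxs -cats1 takel_cat; [apply: regxs | apply: ltnW].
Qed.

Hypothesis odd_nbhd : forall v, v \in Vodd e -> nbhd e v != set0.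

Lemma XU_maxideal v : v \in Vodd e -> maxideal (XU K (nbhd e v)).
Proof.
move=> /odd_nbhd/set0Pn[u uv]; rewrite /XU (bigD1 u) //= mulrC.
have [_ _] := maxideal_ideal; apply; exact: maxideal_var.
Qed.

Lemma Nplus_proper xs : (forall x, x \in xs -> maxideal x) -> ~ ideal_gen e (Nplus e xs) 1.
Proof.
move=> mxs G1; have : maxideal 1.
  apply: ideal_gen_le G1; first exact: maxideal_ideal.
  by move=> g [[v [vO ->]]|/mxs//]; apply: XU_maxideal.
by rewrite /maxideal mcoeff1 eqxx => /eqP; rewrite oner_eq0.
Qed.

(** With a trivial socle, prime avoidance would give a [z] in [maxideal] regular on the last
    quotient. Its even part lies in [R], differs from [z] by a member of the ideal, and so would
    lengthen the sequence. *)
Lemma maximal_regular_seqP xs : maximal_regular_seq_in_m e xs ->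
  [/\ forall x, x \in xs -> inR e x /\ maxideal x, regseq N0 xs &
      socle_free maxideal (foldl addI N0 xs) 1].
Proof.
case=> -[regxs _] xsm xsmax.
have xsR x : x \in xs -> inR e x /\ maxideal x by move/xsm/mgen_maxideal.
have Rxs x : x \in xs -> inR e x by case/xsR.
have rxs := proj1 (regular_seqE Rxs) regxs; split=> //.
have iJ := extended_ideal (Nplus e xs).
rewrite -extended_Nplus //; apply: NNPP => nosoc.
have [Q|z mz zP] := common_nonzerodiv (Js := [:: extended (Nplus e xs)])
    (@noetherian_mpoly K n) maxideal_ideal.
  case=> // <-; split=> // f fsoc; apply: NNPP => nf; apply: nosoc.
  exact: socle_free1 fsoc nf.
have zJ := zP _ (or_introl erefl).
have m_even := even_part_maxideal mz.
have yreg : nonzerodiv (extended (Nplus e xs)) (even_part z).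
  move=> f Jf; apply: zJ.
  have -> : z * f = even_part z * f + f * (z - even_part z) by ring.
  have [_ JD JM] := iJ; apply: JD => //; apply: JM; exact: extended_even_part.
apply: (xsmax (even_part z)); first by apply/mgen_maxideal; split=> //; apply: even_part_inR.
have Rxsz x : x \in rcons xs (even_part z) -> inR e x.
  by rewrite mem_rcons inE => /predU1P[->|/Rxs//]; apply: even_part_inR.
split; first by apply/regular_seqE => //; apply/regseq_rcons; rewrite -extended_Nplus.
apply: Nplus_proper => x; rewrite mem_rcons inE => /predU1P[->//|/xsR[]//].
Qed.

End EvenRing.

(** * The quotient by part of Z *)

Section Quotients.
Variables (K : fieldType) (n : nat) (e : rel 'I_n) (rep : 'I_n -> 'I_n).
Hypotheses (ubf : unmixed_balanced_forest e) (grep : good_rep e rep).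
Notation P := {mpoly K[n]}.
Notation pv := (pivot e rep).
Notation np := (nonpivot e rep).
Notation zz := (zvar e rep K).
Implicit Types (f g : P) (i j s u v w l : 'I_n) (S : seq 'I_n) (m : 'X_{1..n}) (D : {set 'I_n}).

Let odd_nbr v u : v \in Vodd e -> e v u -> u \in Veven e.
Proof. by move=> vO evu; case: (nbhd_even ubf vO evu). Qed.

Let odd_nbhd v : v \in Vodd e -> nbhd e v != set0.
Proof.
by case: ubf => fore _ _; rewrite inE => /(odd_height_nbhd fore); rewrite -card_gt0; case: #|_|.
Qed.

(** Normal form modulo the odd variables and the members of [Z] indexed by [S]. A pivot is never in
    [S], so one substitution suffices. *)
Definition subst S : n.-tuple P :=
  [tuple if i \notin Veven e then 0 else
         if i \in S then if nbhd e i == set0 then 0 else 'X_(pv i) else 'X_i | i < n].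

Definition subst_var S i := if i \in S then pv i else i.

Definition subst_gen S v : 'X_{1..n} := (\sum_(u in nbhd e v) U_(subst_var S u))%MM.

Lemma subst_genE S v j : subst_gen S v j = (\sum_(u in nbhd e v) (subst_var S u == j))%N.
Proof. by rewrite mnm_sumE; apply: eq_bigr => u _; rewrite mnm1E. Qed.

Lemma subst_XU S v : v \in Vodd e -> XU K (nbhd e v) \mPo subst S = 'X_[subst_gen S v].
Proof.
move=> vO; rewrite /XU rmorph_prod -mprodXE; apply: eq_bigr => u; rewrite inE => evu /=.
have [uE u0] := nbhd_even ubf vO evu.
by rewrite comp_mpolyXi tnth_mktuple uE /subst_var (negbTE u0) /=; case: ifP.
Qed.

Notation mono S := (@monomial_ideal K n 'I_n (Vodd e) (subst_gen S)).
Notation J S := (extended e (Nplus e (map zz S))).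

Section Membership.
Variable S : seq 'I_n.
Hypothesis Snp : forall v, v \in S -> np v.

Lemma zvar_inR v : np v -> inR e (zz v).
Proof.
case/andP=> vE _; rewrite /zvar; case: ifPn => v0; first exact: supportedX.
apply: (supportedB (V := mem (Veven e))); apply: supportedX => //.
by have [] := pivotK ubf grep vE v0.
Qed.

Lemma Nplus_zvar_inR g : Nplus e (map zz S) g -> inR e g.
Proof. by apply: Nplus_inR => // _ /mapP[v /Snp vnp ->]; apply: zvar_inR. Qed.

Lemma pivot_notin v : v \in Veven e -> nbhd e v != set0 -> pv v \notin S.
Proof.
move=> vE v0; have [pE p0 _ pp] := pivotK ubf grep vE v0.
by apply/negP => /Snp; rewrite /nonpivot pE (negbTE p0) pp eqxx.
Qed.

Lemma subst_cong f : J S (f - (f \mPo subst S)).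
Proof.
have [J0 JD JM] := extended_ideal e (Nplus e (map zz S)).
have Jmem g : Nplus e (map zz S) g -> J S g.
  by move=> Gg; apply: extended_mem => //; apply: Nplus_zvar_inR.
elim/mpoly_ring_ind: f => [c|i|f g Jf Jg|f g Jf Jg].
- by rewrite comp_mpolyC subrr.
- rewrite comp_mpolyXi tnth_mktuple; case: ifPn => iE; first by rewrite subr0; apply: extended_odd.
  rewrite negbK in iE; case: ifPn => iS; last by rewrite subrr.
  have zi : J S (zz i) by apply: Jmem; right; apply: map_f.
  move: zi; rewrite /zvar; case: ifPn => _; first by rewrite subr0.
  move=> zi; have -> : 'X_i - 'X_(pv i) = -1 * ('X_(pv i) - 'X_i) :> P by ring.
  exact: JM.
- rewrite comp_mpolyD; have -> : f + g - (f \mPo subst S + (g \mPo subst S)) =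
    f - (f \mPo subst S) + (g - (g \mPo subst S)) by ring.
  exact: JD.
- rewrite rmorphM /=; have -> : f * g - (f \mPo subst S) * (g \mPo subst S) =
    g * (f - (f \mPo subst S)) + (f \mPo subst S) * (g - (g \mPo subst S)) by ring.
  by apply: JD; apply: JM.
Qed.

Lemma subst_zvar v : v \in S -> zz v \mPo subst S = 0.
Proof.
move=> vS; have /andP[vE _] := Snp vS; rewrite /zvar; case: ifPn => v0.
  by rewrite comp_mpolyXi tnth_mktuple vE vS v0.
have [pE p0 _ pp] := pivotK ubf grep vE v0.
rewrite comp_mpolyB !comp_mpolyXi !tnth_mktuple vE vS (negbTE v0) pE /=.
by rewrite (negbTE (pivot_notin vE v0)) subrr.
Qed.

(** The substitution kills the members of [Z] in use and turns the other generators into monomials;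
    conversely, by [subst_cong], it changes [f] only within the ideal. All later questions thus
    concern monomial ideals. *)
Lemma mem_extended f : J S f <-> mono S (f \mPo subst S).
Proof.
have iM := monomial_is_ideal K (Vodd e) (subst_gen S); have [M0 MD MM] := iM.
have iJ := extended_ideal e (Nplus e (map zz S)); have [J0 JD JM] := iJ.
split.
  apply: (@extended_le _ _ _ _ (fun f => mono S (f \mPo subst S))).
  - split=> [|g h|g h]; first by rewrite comp_mpoly0.
      by rewrite comp_mpolyD; apply: MD.
    by rewrite rmorphM; apply: MM.
  - move=> g; suff -> : (g - even_part e g) \mPo subst S = 0 by [].
    rewrite comp_mpolyB; apply/eqP; rewrite subr_eq0; apply/eqP.
    elim/mpoly_ring_ind: g => [c|i|g h IHg IHh|g h IHg IHh].
    + by rewrite /even_part !comp_mpolyC.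
    + rewrite /even_part !comp_mpolyXi !tnth_mktuple; case: ifPn => iE /=.
        by rewrite (negbTE iE) comp_mpoly0.
      by rewrite negbK in iE; rewrite iE comp_mpolyXi tnth_mktuple iE.
    + by rewrite even_partD !comp_mpolyD IHg IHh.
    + by rewrite even_partM !rmorphM /= IHg IHh.
  - move=> g [[v [vO ->]]|/mapP[v vS ->]].
      rewrite subst_XU //; apply: monomial_idealX; apply/exists_inP; exists v => //.
      exact: lepm_refl.
    by rewrite subst_zvar.
move=> Mf; apply: (ideal_subl iJ (subst_cong f)); rewrite [_ \mPo _]mpolyE.
apply: ideal_sum => // m /Mf/exists_inP[v vO vm].
rewrite -mul_mpolyC; apply: (JM); rewrite -(submK vm) mpolyXD -subst_XU //; apply: (JM).
have -> : XU K (nbhd e v) \mPo subst S =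
  XU K (nbhd e v) + -1 * (XU K (nbhd e v) - (XU K (nbhd e v) \mPo subst S)) by ring.
apply: JD; last by apply: JM; apply: subst_cong.
by apply: extended_mem; [apply: XU_inR | left; exists v].
Qed.

Lemma subst_var_pivot u : u \in Veven e -> nbhd e u != set0 ->
  subst_var S u = u \/ subst_var S u = pv u.
Proof. by rewrite /subst_var; case: ifP; [right|left]. Qed.

Lemma subst_var_odd v u : v \in Vodd e -> height e v != 1%N -> e v u -> subst_var S u = u.
Proof.
by move=> vO v1 evu; rewrite /subst_var (pivot_odd rep ubf vO v1 evu) if_same.
Qed.

Lemma regular_zvar l : np l -> l \notin S -> regular_on e (Nplus e (map zz S)) (zz l).
Proof.
move=> lnp lS; apply/regular_onE; first exact: zvar_inR.
have /andP[lE lpv] := lnp => f /mem_extended; rewrite rmorphM /= => Mf; apply/mem_extended.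
move: Mf; have Xl : 'X_l \mPo subst S = 'X_l.
  by rewrite comp_mpolyXi tnth_mktuple lE (negbTE lS).
rewrite /zvar; case: ifPn => l0.
  rewrite Xl; apply: nonzerodiv_var => v vO; rewrite subst_genE big1 // => u.
  rewrite inE => evu; have [uE u0] := nbhd_even ubf vO evu.
  have [_ p0 _ _] := pivotK ubf grep uE u0.
  apply/eqP; rewrite eqb0; apply/negP => /eqP ul.
  by have [ul'|ul'] := subst_var_pivot uE u0; move: l0; rewrite -ul ul' ?(negbTE u0) ?(negbTE p0).
have {}lpv : pv l != l by rewrite (negbTE l0) in lpv.
have [pE p0 sp pp] := pivotK ubf grep lE l0.
have pS := pivot_notin lE l0.
have [sl hs] := stemP ubf lE l0.
have spl := pivotP ubf grep lE l0.
have Xp : 'X_(pv l) \mPo subst S = 'X_(pv l).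
  by rewrite comp_mpolyXi tnth_mktuple pE (negbTE pS).
rewrite comp_mpolyB Xl Xp.
(* The bound [a] is the exponent of the pivot in the generator of its own stem, at least 1. No other
   height-1 generator contains the pivot, and a height-3 generator contains it at most once. *)
apply: (nonzerodiv_diff (a := subst_gen S (stem e l) (pv l))) => // v vO.
  have [v1|v1] := eqVneq (height e v) 1%N.
    have [<- //|vs] := eqVneq v (stem e l).
    suff -> : subst_gen S v (pv l) = 0%N by [].
    rewrite subst_genE big1 // => u; rewrite inE => evu; apply/eqP; rewrite eqb0.
    have [uE u0] := nbhd_even ubf vO evu; have [_ _ su _] := pivotK ubf grep uE u0.
    apply: contraNneq vs => ul; rewrite -sp -ul -(stemE ubf v1 evu).
    by have [->|->] := subst_var_pivot uE u0; rewrite ?su.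
  apply: (@leq_trans 1); last first.
    rewrite subst_genE (bigD1 (pv l)) ?inE //=.
    by rewrite /subst_var (negbTE pS) eqxx.
  rewrite subst_genE (eq_bigr (fun u => (u == pv l : nat))); last first.
    by move=> u; rewrite inE => evu; rewrite (subst_var_odd vO v1 evu).
  rewrite big_mkcond (bigD1 (pv l)) //= big1 ?addn0; first by case: ifP; rewrite ?eqxx.
  by move=> u /negbTE->; rewrite if_same.
(* A generator containing the variable of [l] is that of its stem: [l], being no pivot, is not the
   image of another vertex, and neighbors of height-3 vertices are pivots. *)
rewrite subst_genE lt0n sum_nat_eq0 negb_forall => /existsP[u].
rewrite negb_imply eqb0 negbK inE => /andP[evu /eqP ul].
have [uE u0] := nbhd_even ubf vO evu; have [_ _ _ ppu] := pivotK ubf grep uE u0.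
have uE' : u = l.
  by have [<-//|ul'] := subst_var_pivot uE u0; move: lpv; rewrite -ul ul' ppu eqxx.
rewrite uE' in evu.
have [v1|v1] := eqVneq (height e v) 1%N; first by rewrite (stemE ubf v1 evu).
by rewrite (pivot_odd rep ubf vO v1 evu) eqxx in lpv.
Qed.

End Membership.

Lemma zvar_regular_seq S : uniq S -> (forall v, v \in S -> np v) ->
  forall j : nat, (j < size (map zz S))%N ->
    regular_on e (Nplus e (take j (map zz S))) (nth 0 (map zz S) j).
Proof.
move=> uS Snp j; rewrite size_map => jS.
have [x0 _] : exists x0 : 'I_n, True by case: S jS {uS Snp} => // x0; exists x0.
rewrite (nth_map x0) // -map_take; apply: regular_zvar => [v /mem_take/Snp//||].
  by apply/Snp/mem_nth.
by rewrite in_take_leq ?index_uniq ?ltnn // ltnW.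
Qed.

(** The variable of [v] occurs in [zvar v]; in [zvar u] only those of [u] and of a pivot can occur,
    and pivots are never indices. *)
Lemma zvar_inj : {in np &, injective zz}.
Proof.
move=> u v; rewrite !unfold_in => unp vnp zuv.
have zv : (zz v)@_U_(v) != 0.
  have /andP[vE vpv] := vnp; rewrite /zvar; case: ifPn => v0.
    by rewrite mcoeffXU eqxx oner_eq0.
  rewrite (negbTE v0) in vpv; rewrite mcoeffB !mcoeffXU eqxx (negbTE vpv) sub0r.
  by rewrite oppr_eq0 oner_eq0.
move: zv; rewrite -zuv /zvar; have /andP[uE _] := unp; case: ifPn => u0.
  by rewrite mcoeffXU; have [//|_] := eqVneq u v; rewrite eqxx.
have [pE p0 _ pp] := pivotK ubf grep uE u0.
rewrite mcoeffB !mcoeffXU; have [pv_v|_] := eqVneq (pv u) v.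
  by move: vnp; rewrite /nonpivot -pv_v (negbTE p0) pp eqxx andbF.
by have [//|_] := eqVneq u v; rewrite subr0 eqxx.
Qed.

Lemma zvar_maxideal v : maxideal (zz v).
Proof.
rewrite /zvar; case: ifP => _; first exact: maxideal_var.
by have := idealB (maxideal_ideal K n) (maxideal_var K (pv v)) (maxideal_var K v).
Qed.


(** * Socle of the quotient by all of [Z] *)

Definition is_pivot i := [&& i \in Veven e, nbhd e i != set0 & pv i == i].

Definition degree_of i := #|nbhd e (stem e i)|.

Lemma degree_gt1 p : is_pivot p -> (1 < degree_of p)%N.
Proof.
case/and3P=> pE p0 _; case: ubf => fore _ _; have [_ hs] := stemP ubf pE p0.
by apply: (odd_height_nbhd fore); rewrite hs.
Qed.

Lemma pivot_of u : u \in Veven e -> nbhd e u != set0 -> is_pivot (pv u).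
Proof.
by move=> uE u0; have [pE p0 _ pp] := pivotK ubf grep uE u0; apply/and3P; rewrite pp eqxx.
Qed.

Lemma height3_odd w : w \in Vk e 3 -> w \in Vodd e /\ height e w != 1%N.
Proof. by rewrite !inE => /eqP->. Qed.

Lemma height3_pivot w u : w \in Vk e 3 -> e w u -> is_pivot u.
Proof.
move=> /height3_odd[wO w1] ewu; have [uE u0] := nbhd_even ubf wO ewu.
by apply/and3P; rewrite (pivot_odd rep ubf wO w1 ewu) eqxx.
Qed.

(** Removing [d] fails exactly when some [w] of height 3 meets [D] in [d] alone; the socle
    computation uses these private neighbors. *)
Lemma min_V3TDP D : minset (V3TD e) D <->
  (forall w, w \in Vk e 3 -> exists2 d, d \in D & e w d) /\
  (forall d, d \in D -> exists w, [/\ w \in Vk e 3, e w d & forall u, e w u -> u \in D -> u = d]).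
Proof.
case: (ubf) => fore _ _; split=> [/minsetP[VD Dmin]|[VD Dpriv]].
  have DV := hits_nbhdsP fore _ _ VD; split=> // d dD.
  apply: NNPP => nw; suff /setP/(_ d) : D :\ d = D by rewrite !inE eqxx dD.
  apply: Dmin; last exact: subsetDl.
  apply/(hits_nbhdsP fore) => w w3; have [d' d'D ewd'] := DV w w3.
  have [d'd|d'd] := eqVneq d' d; last by exists d'; rewrite // !inE d'd.
  rewrite d'd in ewd'; apply: NNPP => nd'; apply: nw; exists w; split=> // u ewu uD.
  by apply/eqP; apply: contraT => ud; case: nd'; exists u; rewrite // !inE ud.
apply/minsetP; split; first by apply/(hits_nbhdsP fore).
move=> B /(hits_nbhdsP fore) VB BD; apply/eqP; rewrite eqEsubset BD; apply/subsetP => d dD.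
have [w [w3 ewd wd]] := Dpriv d dD; have [b bB ewb] := VB w w3.
by rewrite -(wd b ewb (subsetP BD b bB)).
Qed.

Lemma min_V3TD_pivot D d : minset (V3TD e) D -> d \in D -> is_pivot d.
Proof. by move=> /min_V3TDP[_ Dpriv] /Dpriv[w [w3 ewd _]]; apply: height3_pivot ewd. Qed.

(* The monomial socle element attached to a minimal [V_3]-TD-set [D] omits exactly the pivots in [D]. *)
Definition socle_exponent D : 'X_{1..n} :=
  [multinom if is_pivot i && (i \notin D) then (degree_of i).-1 else 0%N | i < n].

Lemma socle_exponentE D i :
  socle_exponent D i = if is_pivot i && (i \notin D) then (degree_of i).-1 else 0%N.
Proof. exact: mnmE. Qed.

(** [D] is recovered as the set of pivots of exponent zero: a pivot outside [D] has exponent one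
    less than a degree that is at least 2. *)
Lemma socle_exponent_inj : {in [set D | minset (V3TD e) D] &, injective socle_exponent}.
Proof.
have memE D x : minset (V3TD e) D -> (x \in D) = is_pivot x && (socle_exponent D x == 0%N).
  move=> Dmin; rewrite socle_exponentE; case: (boolP (is_pivot x)) => [xp|nxp] /=.
    by case: (boolP (x \in D)) => //= _; have := degree_gt1 xp; case: degree_of => [|[]].
  by apply: contraNF nxp; apply: min_V3TD_pivot Dmin.
move=> D1 D2; rewrite !inE => D1min D2min E; apply/setP => x.
by rewrite (memE D1) // (memE D2) // E.
Qed.

Section Artinian.
Variable S : seq 'I_n.
Hypothesis Snp : forall v, (v \in S) = np v.
Notation div := (@divisible n 'I_n (Vodd e) (subst_gen S)).

Let SnpW v : v \in S -> np v. Proof. by rewrite Snp. Qed.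

Lemma subst_var_full u : u \in Veven e -> nbhd e u != set0 -> subst_var S u = pv u.
Proof.
by move=> uE u0; rewrite /subst_var Snp /nonpivot uE (negbTE u0) /=; case: eqP => // ->.
Qed.

(** All neighbors of a height-1 vertex share one pivot, whence a pure power; those of a height-3
    vertex are distinct pivots, whence a squarefree monomial. *)
Lemma divisibleP m : reflect
  ((exists2 p, is_pivot p & (degree_of p <= m p)%N) \/
   (exists2 w, w \in Vk e 3 & forall u, e w u -> (0 < m u)%N)) (div m).
Proof.
case: (ubf) => fore bal unm.
apply: (iffP exists_inP) => [[v vO /mnm_lepP vm]|[[p pp pm]|[w w3 wm]]].
- have [v1|v1] := eqVneq (height e v) 1%N; [left | right].
    have /set0Pn[u uv] := odd_nbhd vO; have evu := uv; rewrite inE in evu.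
    have [uE u0] := nbhd_even ubf vO evu; have su := stemE ubf v1 evu.
    have [_ _ spu _] := pivotK ubf grep uE u0.
    exists (pv u); first exact: pivot_of.
    apply: leq_trans (vm (pv u)); rewrite subst_genE /degree_of spu su -sum1_card.
    apply: leq_sum => u'; rewrite inE => evu'; have [u'E u'0] := nbhd_even ubf vO evu'.
    by rewrite subst_var_full // (pivot_const ubf grep v1 evu' evu) eqxx.
  exists v; first by rewrite inE (height3 fore bal unm vO v1).
  move=> u evu; apply: leq_trans (vm u); rewrite subst_genE (bigD1 u) ?inE //=.
  have [uE u0] := nbhd_even ubf vO evu.
  by rewrite subst_var_full // (pivot_odd rep ubf vO v1 evu) eqxx.
- have /and3P[pE p0 /eqP ppE] := pp; have [sp hs] := stemP ubf pE p0.
  have sO := height1_odd hs.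
  exists (stem e p) => //; apply/mnm_lepP => j; rewrite subst_genE.
  rewrite (eq_bigr (fun=> (p == j : nat))) => [|u]; last first.
    rewrite inE => esu; have [uE u0] := nbhd_even ubf sO esu.
    by rewrite subst_var_full // (pivot_const ubf grep hs esu sp) ppE.
  have [<-|pj] := eqVneq p j; last by rewrite big1.
  by rewrite sum1_card.
- have [wO w1] := height3_odd w3; exists w => //; apply/mnm_lepP => j; rewrite subst_genE.
  rewrite (eq_bigr (fun u => (u == j : nat))); last first.
    move=> u; rewrite inE => ewu; have [uE u0] := nbhd_even ubf wO ewu.
    by rewrite subst_var_full // (pivot_odd rep ubf wO w1 ewu).
  rewrite big_mkcond (bigD1 j) //= eqxx big1 => [|u /negbTE->]; last by rewrite if_same.
  by rewrite addn0; case: ifP => //; rewrite inE => /wm.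
Qed.

Lemma socle_exponent_ndiv D : minset (V3TD e) D -> ~~ div (socle_exponent D).
Proof.
move=> /min_V3TDP[DV _]; apply/divisibleP => -[[p pp]|[w w3 wD]].
  by rewrite socle_exponentE pp /=; have := degree_gt1 pp; case: ifP => _; lia.
have [d dD ewd] := DV w w3; have := wD d ewd.
by rewrite socle_exponentE dD andbF.
Qed.

(** For [p] in [D], a private [w] has its other neighbors outside [D], hence with positive
    exponents, and [p] completes its monomial. For [p] outside [D], the power of [p] is
    completed. *)
Lemma socle_exponent_div D p : minset (V3TD e) D -> is_pivot p ->
  div (socle_exponent D + U_(p)).
Proof.
move=> /min_V3TDP[DV Dpriv] pp; apply/divisibleP.
case: (boolP (p \in D)) => pD; [right | left].
  have [w [w3 ewp wp]] := Dpriv p pD; exists w => // u ewu.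
  rewrite mnmDE mnm1E; have [_|pu] := eqVneq p u; first by rewrite addn1.
  have up := height3_pivot w3 ewu.
  rewrite socle_exponentE up /= ifT; first by have := degree_gt1 up; lia.
  by apply: contraNN pu => /(wp u ewu)->.
exists p => //; rewrite mnmDE mnm1E eqxx socle_exponentE pp pD /=.
by have := degree_gt1 pp; lia.
Qed.

(** [D] must be the set of pivots absent from [m]. It dominates each [w] of height 3 because the
    monomial of [w] does not divide [m]; and multiplying by a [p] in [D] can complete only a
    squarefree generator, which yields the private neighbor of [p]. *)
Lemma socle_exponentP m : (forall i, (0 < m i)%N -> is_pivot i) -> ~~ div m ->
  (forall p, is_pivot p -> div (m + U_(p))) ->
  exists2 D, minset (V3TD e) D & m = socle_exponent D.
Proof.
move=> mp /divisibleP nd mU; pose D := [set p | is_pivot p && (m p == 0%N)].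
(* Multiplying by a [p] already present adds nothing to the support, so it must complete the power
   of [p]. *)
have top p : is_pivot p -> (0 < m p)%N -> m p = (degree_of p).-1.
  move=> pp m0; have mpd : (m p < degree_of p)%N.
    by rewrite ltnNge; apply/negP => dm; apply: nd; left; exists p.
  case/divisibleP: (mU p pp) => [[q qp]|[w w3 wm]]; last first.
    case: nd; right; exists w => // u ewu; have := wm u ewu.
    by rewrite mnmDE mnm1E; have [<-|] := eqVneq p u; rewrite ?addn0.
  rewrite mnmDE mnm1E; have [<-|_] := eqVneq p q; first by lia.
  by rewrite addn0 => dm; case: nd; left; exists q.
exists D.
  apply/min_V3TDP; split=> [w w3|d].
    apply: NNPP => nw; apply: nd; right; exists w => // u ewu.
    rewrite lt0n; apply/negP => mu; apply: nw; exists u => //.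
    by rewrite inE mu (height3_pivot w3 ewu).
  rewrite inE => /andP[dp /eqP md]; case/divisibleP: (mU d dp) => [[q qp]|[w w3 wm]].
    rewrite mnmDE mnm1E; have [<-|_] := eqVneq d q; last first.
      by rewrite addn0 => dm; case: nd; left; exists q.
    by rewrite md => dle; have := degree_gt1 dp; lia.
  exists w; split=> //.
    apply: NNPP => nwd; apply: nd; right; exists w => // u ewu; have := wm u ewu.
    by rewrite mnmDE mnm1E; have [dE|_] := eqVneq d u; [rewrite dE ewu in nwd | rewrite addn0].
  move=> u ewu; rewrite inE => /andP[_ /eqP mu]; have := wm u ewu.
  by rewrite mnmDE mnm1E mu; case: eqP.
apply/mnmP => i; rewrite socle_exponentE; case: (boolP (is_pivot i)) => ip /=; last first.
  by apply/eqP; rewrite -leqn0 leqNgt; apply: contra ip; apply: mp.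
rewrite inE ip /=; case: (posnP (m i)) => [->//|mi].
by rewrite /= top.
Qed.

Lemma subst_supported f : supported is_pivot (f \mPo subst S).
Proof.
apply: supported_comp => i; rewrite tnth_mktuple; case: ifPn => iE; first exact: supported0.
rewrite negbK in iE; rewrite Snp /nonpivot iE /=.
have [i0|i0] := eqVneq (nbhd e i) set0; first exact: supported0.
case: ifPn => /= pi; first exact/supportedX/pivot_of.
by rewrite negbK in pi; apply: supportedX; apply/and3P.
Qed.

Lemma subst_id f : supported is_pivot f -> f \mPo subst S = f.
Proof.
apply: comp_mpoly_supported => i /and3P[iE i0 pi].
by rewrite tnth_mktuple iE Snp /nonpivot iE (negbTE i0) pi.
Qed.

Lemma socle_exponent_supported D : supported is_pivot ('X_[socle_exponent D] : P).
Proof.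
move=> m; rewrite msuppX inE => /eqP-> i; rewrite socle_exponentE.
by case: is_pivot.
Qed.

Lemma socle_exponent_socle D : minset (V3TD e) D ->
  socle (@maxideal K n) (J S) 'X_[socle_exponent D].
Proof.
move=> Dmin; apply: socle_extended => v vE; apply/mem_extended => //.
rewrite rmorphM /= (subst_id (@socle_exponent_supported D)) comp_mpolyXi tnth_mktuple vE /=.
have [M0 _ MM] := monomial_is_ideal K (Vodd e) (subst_gen S).
have pX p : is_pivot p -> mono S ('X_p * 'X_[socle_exponent D]).
  by move=> pp; rewrite -mpolyXD addmC; apply: monomial_idealX; apply: socle_exponent_div.
rewrite Snp /nonpivot vE /=; have [v0|v0] := eqVneq (nbhd e v) set0; first by rewrite mul0r.
case: ifPn => /= pi; first exact/pX/pivot_of.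
by rewrite negbK in pi; apply: pX; apply/and3P.
Qed.

(** Modulo a monomial ideal, every monomial of a socle element that is outside the ideal is itself
    in the socle, hence has exponent [socle_exponent D] for some [D]. *)
Lemma mem_of_socle f : socle (@maxideal K n) (J S) f ->
  (forall D, minset (V3TD e) D -> (f \mPo subst S)@_(socle_exponent D) = 0) -> J S f.
Proof.
move=> fsoc f0; apply/mem_extended => // m mf; apply: contraT => nd.
have [||D Dmin mD] := socle_exponentP _ nd.
- exact: (subst_supported mf).
- move=> p pp; have /and3P[pE p0 ppE] := pp.
  have /mem_extended := fsoc _ (maxideal_var K p); move/(_ SnpW).
  rewrite rmorphM /= (subst_id (supportedX pp)); apply.
  by rewrite mcoeff_msupp mcoeffXiM mnmDE mnm1E eqxx addn1 /= addmK -mcoeff_msupp.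
by move: mf; rewrite mcoeff_msupp mD f0 ?eqxx.
Qed.

Notation T := [set D : {set 'I_n} | minset (V3TD e) D].

Lemma socle_free_V3TD : socle_free (@maxideal K n) (J S) (num_min_V3TD e).
Proof.
pose fs : seq P := [seq 'X_[socle_exponent D] | D <- enum T].
have szT : size (enum T) = num_min_V3TD e by rewrite -cardE.
exists fs; split=> [|f /mapP[D + ->]|c szc Jc i]; first by rewrite size_map.
  by rewrite mem_enum inE; apply: socle_exponent_socle.
have fsE (j : nat) : (j < num_min_V3TD e)%N -> fs`_j = 'X_[socle_exponent (nth set0 (enum T) j)].
  by move=> jt; rewrite (nth_map set0) ?szT.
case: (ltnP i (num_min_V3TD e)) => it; last by rewrite nth_default ?szc.
have DT (j : nat) : (j < num_min_V3TD e)%N -> nth set0 (enum T) j \in T.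
  by move=> jt; rewrite -mem_enum mem_nth ?szT.
pose D := nth set0 (enum T) i.
have Dmin : minset (V3TD e) D by have := DT i it; rewrite inE.
move/mem_extended: Jc => /(_ SnpW); rewrite subst_id; last first.
  apply: (big_ind (supported is_pivot)); [exact: supported0 | exact: supportedD |].
  move=> j _; rewrite fsE // -mul_mpolyC; apply: supportedM; first exact: supportedC.
  exact: socle_exponent_supported.
move=> Jc; apply/eqP; apply: contraT => ci.
case/negP: (socle_exponent_ndiv Dmin); apply: Jc; rewrite mcoeff_msupp.
rewrite (raddf_sum (mcoeff _)) /= (bigD1 (Ordinal it)) //= big1 ?addr0 => [|j ji].
  by rewrite mcoeffZ fsE // mcoeffX eqxx mulr1.
rewrite mcoeffZ fsE // mcoeffX; case: eqP => [/socle_exponent_inj jD|_]; last by rewrite mulr0.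
case/eqP: ji; apply: val_inj => /=; apply/eqP.
rewrite -(nth_uniq set0 (s := enum T)) ?szT ?enum_uniq //; apply/eqP.
by apply: jD; apply: DT.
Qed.

(** With more elements, the rows of their coefficients at the exponents [socle_exponent D] are
    dependent, and the corresponding combination lies in the ideal. *)
Lemma socle_free_le_V3TD k : socle_free (@maxideal K n) (J S) k -> (k <= num_min_V3TD e)%N.
Proof.
case=> fs [szfs fsm fsfree]; rewrite leqNgt; apply/negP => kt.
pose mu (j : 'I_(num_min_V3TD e)) := socle_exponent (enum_val j).
pose M : 'M[K]_(k, num_min_V3TD e) := \matrix_(i, j) (fs`_i \mPo subst S)@_(mu j).
have : kermx M != 0.
  by rewrite -mxrank_eq0 mxrank_ker -lt0n subn_gt0 (leq_ltn_trans (rank_leq_col M)).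
case/rowV0Pn=> c /sub_kermxP cM c0.
have iJ := extended_ideal e (Nplus e (map zz S)).
pose cs := [seq c 0 j | j : 'I_k <- enum 'I_k].
have csE (i : 'I_k) : cs`_i = c 0 i.
  by rewrite (nth_map i) ?size_enum_ord // nth_ord_enum.
have fsi (i : 'I_k) : fs`_i \in fs by rewrite mem_nth ?szfs.
case/negP: c0; apply/eqP/rowP => i; rewrite mxE -csE; apply: fsfree.
  by rewrite size_map size_enum_ord.
apply: mem_of_socle.
  move=> a ma; rewrite mulr_sumr; apply: ideal_sum => // j _.
  by rewrite -scalerAr -mul_mpolyC; case: iJ => _ _; apply; apply: (fsm _ (fsi j)).
move=> D Dmin; have DT : D \in T by rewrite inE.
have := congr1 (fun N : 'rV_(num_min_V3TD e) => N 0 (enum_rank_in DT D)) cM; rewrite !mxE => cMD.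
rewrite /comp_mpoly (raddf_sum (mmap _ _)) (raddf_sum (mcoeff _)) /= -[RHS]cMD.
apply: eq_bigr => j _; rewrite -/(comp_mpoly _ _) comp_mpolyZ mcoeffZ csE !mxE /mu.
by rewrite enum_rankK_in.
Qed.

(** No further element [y] can be regular: it multiplies a socle monomial, which is outside the
    ideal, into the ideal. *)
Lemma zvar_maximal : uniq S -> maximal_regular_seq_in_m e (map zz S).
Proof.
move=> uS; have zR x : x \in map zz S -> inR e x /\ maxideal x.
  by case/mapP=> v /SnpW vnp ->; split; [apply: zvar_inR | apply: zvar_maxideal].
split.
- split; first exact: (zvar_regular_seq uS SnpW).
  by apply: Nplus_proper => // x /zR[].
- by move=> x /zR ?; apply/mgen_maxideal.
move=> y /mgen_maxideal[Ry my] [regy _].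
have := regy (size (map zz S)); rewrite size_rcons ltnSn => /(_ isT).
rewrite nth_rcons ltnn eqxx -cats1 take_size_cat // => /(regular_onE _ Ry) yreg.
have [D Dmin _] : {D | minset (V3TD e) D & D \subset setT}.
  case: ubf => fore _ _; apply: minset_exists; apply/(hits_nbhdsP fore) => w w3.
  have [wO _] := height3_odd w3; have /set0Pn[u] := odd_nbhd wO.
  by rewrite inE => ewu; exists u.
have /mem_extended : J S 'X_[socle_exponent D].
  by apply: yreg; apply: socle_exponent_socle.
move/(_ SnpW); rewrite (subst_id (@socle_exponent_supported D)) => /(_ (socle_exponent D)).
by rewrite msuppX mem_head => /(_ isT); apply/negP/socle_exponent_ndiv.
Qed.

End Artinian.

Lemma CM_type_V3TD : CM_type_is e K (num_min_V3TD e).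
Proof.
pose S := enum np.
have Snp v : (v \in S) = np v by rewrite mem_enum.
have SnpW v : v \in S -> np v by rewrite Snp.
have Zmax := zvar_maximal Snp (enum_uniq np).
have [zR zreg zsoc] := maximal_regular_seqP odd_nbr odd_nbhd Zmax.
move=> xs /(maximal_regular_seqP odd_nbr odd_nbhd)[xR xreg xsoc].
have same t : socle_free (@maxideal K n) (extended e (Nplus e xs)) t <-> socle_free (@maxideal K n) (J S) t.
  have xsR x : x \in xs -> inR e x by case/xR.
  have zsR x : x \in map zz S -> inR e x by case/zR.
  have xsm x : x \in xs -> maxideal x by case/xR.
  have zsm x : x \in map zz S -> maxideal x by case/zR.
  have iN := extended_ideal e (Nplus e (K := K) [::]).
  rewrite (extended_Nplus odd_nbr xsR) (extended_Nplus odd_nbr zsR).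
  split; apply: (socle_free_regseq (maxideal_ideal K n) (@noetherian_mpoly K n) iN) => //.
split.
  have [fs] := proj1 (socle_freeP _ _ _) (proj2 (same _) (socle_free_V3TD Snp)).
  by exists fs.
move=> fs fsi; apply: (socle_free_le_V3TD Snp); apply/same/socle_freeP.
by exists fs.
Qed.

End Quotients.

Theorem theorem5p18 (K : fieldType) (n : nat) (e : rel 'I_n) (rep : 'I_n -> 'I_n) :
  unmixed_balanced_forest e -> good_rep e rep ->
  (forall zs : seq {mpoly K[n]}, uniq zs -> (forall p, p \in zs <-> Zset e rep p) ->
     maximal_regular_seq_in_m e zs) /\
  CM_type_is e K (num_min_V3TD e).
Proof.
move=> ubf grep; split; last exact: CM_type_V3TD ubf grep.
move=> zs uzs zsP.
have zvarK p : p \in zs -> exists2 v, nonpivot e rep v & p = zvar e rep K v.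
  by move/zsP/(ZsetP rep ubf).
have [vs zsE vsnp] : exists2 vs, zs = map (zvar e rep K) vs & forall v, v \in vs -> nonpivot e rep v.
  elim: zs {uzs zsP} zvarK => [_|p zs IH zvarK]; first by exists [::].
  have [v vnp pE] := zvarK p (mem_head _ _).
  have [|vs -> vsnp] := IH; first by move=> q qzs; apply: zvarK; rewrite inE qzs orbT.
  exists (v :: vs); first by rewrite /= pE.
  by move=> u; rewrite inE => /predU1P[->|/vsnp].
rewrite zsE in uzs zsP *.
(* Regularity was proved for every order of the indices; injectivity of [zvar] shows that an
   enumeration of [Z] uses every index. *)
suff vsE : forall v, (v \in vs) = nonpivot e rep v.
  exact: (zvar_maximal K ubf grep vsE (map_uniq uzs)).
move=> v; apply/idP/idP => [/vsnp//|vnp].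
have /zsP/mapP[u uvs vu] : Zset e rep (zvar e rep K v) by apply/(ZsetP rep ubf); exists v.
by rewrite (zvar_inj ubf grep vnp (vsnp u uvs) vu).
Qed.
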